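(* Let $\mathfrak g$ be a nonabelian nilpotent Lie algebra, with centre $\mathfrak z$ and derived algebra $\mathfrak g'=[\mathfrak g,\mathfrak g]$. Then: (a) $\mathfrak g_< = \varnothing$, $\ \mathfrak g_{\le}=\mathfrak g_0=\{0\}$, $\ \mathfrak g_{\ge}=\mathfrak z$, $\ \mathfrak g_>=(\mathfrak g'\cap\mathfrak z)\setminus\{0\}$. (b) $\mathfrak G_< = \varnothing$, $\ \mathfrak G_{\le}=\mathfrak G_0=G(2,\mathfrak z)$, $$\begin{aligned}\mathfrak G_{\ge} &=\{\operatorname{Span}(X,Y)\in G(2,\mathfrak g) : [X,Y]=0 \text{ and for all } Z\in\mathfrak g,\ [X,Z]\parallel[Y,Z]\}\\ &=\{\sigma\in G(2,\mathfrak g) : [\sigma,\sigma]=0 \text{ and for all } Z\in\mathfrak g \text{ there exists a nonzero } X\in\sigma \text{ with } [X,Z]=0\},\\ \mathfrak G_> &=\{\operatorname{Span}(X,Y)\in G(2,\mathfrak g) : X\in[Y,\mathfrak g]\cap\mathfrak z\}.\end{aligned}$$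
   Context: Lie algebras are real and finite-dimensional. A positive definite inner product on $\mathfrak g$ determines a left-invariant Riemannian metric on a Lie group with Lie algebra $\mathfrak g$; the Ricci curvature $\operatorname{Ric}(X)=\operatorname{Ric}(X,X)$ of $X\in\mathfrak g$ and the sectional curvature of a two-plane in $\mathfrak g$ are those of this metric (at the identity). Explicitly, for an inner product $\langle\cdot,\cdot\rangle$ on $\mathfrak g$, the sectional curvature of $\sigma=\operatorname{Span}(X,Y)$ is $K(X,Y)\|X\wedge Y\|^{-2}$ where $$K(X,Y)=\|\mathbf U(X,Y)\|^2-\langle \mathbf U(X,X),\mathbf U(Y,Y)\rangle-\tfrac34\|[X,Y]\|^2-\tfrac12\langle[X,[X,Y]],Y\rangle-\tfrac12\langle[Y,[Y,X]],X\rangle,$$ with $\langle \mathbf U(V,W),Z\rangle=\tfrac12(\langle V,[Z,W]\rangle+\langle W,[Z,V]\rangle)$; and, for $\mathfrak g$ nilpotent with orthonormal basis $\{e_i\}$, $\operatorname{Ric}(X)=\frac14\sum_{i,j}\langle X,[e_i,e_j]\rangle^2-\frac12\sum_i\|[X,e_i]\|^2$. $\mathfrak g_>,\mathfrak g_{\ge},\mathfrak g_0,\mathfrak g_{\le},\mathfrak g_<$ denote the subsets of vectors $X\in\mathfrak g$ such that for every choice of the inner product on $\mathfrak g$ the Ricci curvature $\operatorname{Ric}(X)$ is positive, nonnegative, zero, nonpositive, negative, respectively. $G(2,\mathfrak g)$ (resp. $G(2,\mathfrak z)$) is the Grassmannian of (two-dimensional) two-planes lying in $\mathfrak g$ (resp.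 $\mathfrak z$). $\mathfrak G_>,\mathfrak G_{\ge},\mathfrak G_0,\mathfrak G_{\le},\mathfrak G_<$ denote the subsets of two-planes $\sigma\in G(2,\mathfrak g)$ such that for every choice of the inner product on $\mathfrak g$ the sectional curvature of $\sigma$ is positive, nonnegative, zero, nonpositive, negative, respectively. $U\parallel V$ means that $U$ and $V$ are linearly dependent (so the zero vector is parallel to every vector). $[Y,\mathfrak g]=\{[Y,Z]:Z\in\mathfrak g\}$. In the set-builder descriptions, a two-plane belongs to the set if it admits some basis $X,Y$ with the stated property. *)

(* Defs.v *)
From HB Require Import structures.
From mathcomp Require Import all_boot all_order all_algebra ring.
From mathcomp Require Import boolp classical_sets reals.

Set Implicit Arguments.
Unset Strict Implicit.
Unset Printing Implicit Defensive.

Import Order.TTheory GRing.Theory Num.Theory.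
Local Open Scope classical_set_scope.
Local Open Scope ring_scope.

HB.mixin Record Vector_isLieAlgebra (R : fieldType) g of Vector R g := {
  lie : g -> g -> g;
  lie_linearl : forall y : g, linear (lie^~ y);
  lie_linearr : forall x : g, linear (lie x);
  liexx : forall x : g, lie x x = 0;
  lie_jacobi : forall x y z : g,
    lie x (lie y z) + lie y (lie z x) + lie z (lie x y) = 0
}.

#[short(type="lieAlgType")]
HB.structure Definition LieAlgebra (R : fieldType) :=
  {g of Vector R g & Vector_isLieAlgebra R g}.

HB.instance Definition _ (R : fieldType) (g : lieAlgType R) :=
  bilinear_isBilinear.Build R g g g *:%R *:%R (@lie R g)
    (pair (@lie_linearl R g) (@lie_linearr R g)).

Section LieAlgebraTheory.
Context (R : fieldType) (g : lieAlgType R).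
Implicit Types (x y z : g) (U V W : {vspace g}).

Lemma lieDl x y z : lie (x + y) z = lie x z + lie y z.
Proof. exact: linearDl. Qed.

Lemma lieDr x y z : lie x (y + z) = lie x y + lie x z.
Proof. exact: linearDr. Qed.

Lemma lie0r x : lie x 0 = 0.
Proof. exact: linear0r. Qed.

Lemma lieNl x y : lie (- x) y = - lie x y.
Proof. exact: linearNl. Qed.

Lemma lieNr x y : lie x (- y) = - lie x y.
Proof. exact: linearNr. Qed.

Lemma lieZl (a : R) x y : lie (a *: x) y = a *: lie x y.
Proof. exact: linearZl_LR. Qed.

Lemma lieZr (a : R) x y : lie x (a *: y) = a *: lie x y.
Proof. exact: linearZr_LR. Qed.

Lemma lieC x y : lie x y = - lie y x.
Proof.
have := liexx (x + y); rewrite linearDl/= !linearDr/= !liexx add0r addr0.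
by move/eqP; rewrite addr_eq0 => /eqP.
Qed.

Definition lie_abelian := forall x y, lie x y = 0.

Definition lie_center : set g := [set x | forall y, lie x y = 0].

(* The span of all brackets [x, y] with x \in U and y \in V: see memv_lieprod
   and lieprod_sub. *)
Definition lieprod U V : {vspace g} :=
  <<allpairs (@lie R g) (vbasis U) (vbasis V)>>%VS.

Lemma memv_lieprod U V x y : x \in U -> y \in V -> lie x y \in lieprod U V.
Proof.
move=> /coord_vbasis-> /coord_vbasis->.
rewrite linear_sumlz memv_suml// => i _; rewrite linear_sumr memv_suml// => j _.
rewrite linearZl_LR linearZr_LR/= !memvZ// memv_span//.
by apply: allpairs_f; rewrite mem_nth// size_tuple.
Qed.

Lemma lieprod_sub U V W :
  (forall x y, x \in U -> y \in V -> lie x y \in W) -> (lieprod U V <= W)%VS.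
Proof.
move=> UVW; apply/span_subvP => _ /allpairsP[[x y]/= [xU yV ->]].
by apply: UVW; apply: vbasis_mem.
Qed.

Definition lie_derived : {vspace g} := lieprod fullv fullv.

(* Indexed so that lower_central 0 is the whole algebra. *)
Definition lower_central n : {vspace g} := iter n (lieprod fullv) fullv.
Definition lie_nilpotent := exists n, lower_central n = 0%VS.

End LieAlgebraTheory.

Section InnerProduct.
Context (R : realType) (g : vectType R) (b : {dot g for idfun}).
Implicit Types (x y z : g) (V : {vspace g}) (e : seq g).

Lemma dotC x y : b x y = b y x.
Proof. by rewrite hermC/= mul1r. Qed.

Lemma dotDl x y z : b (x + y) z = b x z + b y z.
Proof. exact: linearDl. Qed.

Lemma dotDr x y z : b x (y + z) = b x y + b x z.
Proof. exact: linearDr. Qed.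

Lemma dot0l x : b 0 x = 0.
Proof. exact: linear0l. Qed.

Lemma dotNl x y : b (- x) y = - b x y.
Proof. exact: linearNl. Qed.

Lemma dotNr x y : b x (- y) = - b x y.
Proof. exact: linearNr. Qed.

Lemma dotZl a x y : b (a *: x) y = a * b x y.
Proof. exact: linearZl_LR. Qed.

Lemma dotZr a x y : b x (a *: y) = a * b x y.
Proof. exact: linearZr_LR. Qed.

Lemma dot_ge0 x : 0 <= b x x.
Proof.
by have [->|/neq0_dnorm_gt0/ltW//] := eqVneq x 0; rewrite linear0r.
Qed.

Lemma dot_eq0 x : (b x x == 0) = (x == 0).
Proof.
have [->|/neq0_dnorm_gt0 xgt0] := eqVneq x 0; first by rewrite linear0r eqxx.
by rewrite gt_eqF// xgt0.
Qed.

Lemma dot_inj x y : (forall z, b x z = b y z) -> x = y.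
Proof.
move=> xy; apply/eqP; rewrite -subr_eq0 -dot_eq0 linearBl/= xy.
by rewrite subrr.
Qed.

Definition orthonormal_basis e := basis_of fullv e && orthonormal b e.

Lemma orthonormal_span V :
  exists e, [/\ size e = \dim V, <<e>>%VS = V & orthonormal b e].
Proof.
move: {2}(\dim V) (erefl (\dim V)) => n; elim: n V => [|n IH] V dV.
  exists [::]; rewrite dV span_nil; split => //.
  by apply/esym/eqP; rewrite -dimv_eq0 dV.
have V0 : V != 0%VS by rewrite -dimv_eq0 dV.
pose v0 := vpick V; have v0V : v0 \in V by exact: memv_pick.
have v00 : v0 != 0 by rewrite vpick0.
have bv0 : 0 < b v0 v0 by exact: neq0_dnorm_gt0.
pose v := (Num.sqrt (b v0 v0))^-1 *: v0.
have vV : v \in V by rewrite memvZ.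
have bv : b v v = 1.
  rewrite linearZl_LR linearZr_LR/= mulrA -invfM -expr2 sqr_sqrtr ?ltW//.
  by rewrite mulVf// gt_eqF.
have vNo : v \notin orthov b V.
  by apply/mem_orthovPn; exists v => //=; rewrite [X in X != _]bv oner_eq0.
have /= := eq_dim_orthov1 vNo; rewrite dV/= => /esym dW.
have [e [se spe oe]] := IH _ dW.
have ve u : u \in <<e>>%VS -> b v u = 0.
  rewrite spe memv_cap => /andP[_ /mem_orthovP/(_ _ (memv_line v))].
  by rewrite dotC.
have VE : <<v :: e>>%VS = V.
  apply/eqP; rewrite eqEsubv span_cons spe; apply/andP; split.
    by rewrite subv_add -memvE vV capvSl.
  apply/subvP => x xV; rewrite -(subrK (b v x *: v) x) addrC.
  apply: memv_add; first by rewrite memvZ ?memv_line.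
  rewrite memv_cap rpredB ?memvZ//= mem_orthov1 linearBl/= linearZl_LR/= bv.
  by rewrite mulr1 dotC subrr.
exists (v :: e); split=> /=; [by rewrite se dW|by []|].
case/andP: oe => oe1 oe2; apply/andP; split => /=.
  by rewrite bv eqxx.
rewrite oe2 andbT; apply/andP; split => //; apply/allP => u ue /=.
by rewrite ve ?memv_span.
Qed.

Lemma orthonormal_basis_ex : exists e, orthonormal_basis e.
Proof.
have [e [se spe oe]] := orthonormal_span fullv.
by exists e; rewrite /orthonormal_basis oe andbT basisEdim spe subvv se leqnn.
Qed.

Lemma orthonormal_sum e x : orthonormal_basis e ->
  x = \sum_(u <- e) b x u *: u.
Proof.
move=> /andP[/andP[/eqP spe _] oe].
have {spe} : x \in <<e>>%VS by rewrite spe memvf.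
elim: e oe x => [|u e IH] /=.
  by move=> _ x; rewrite span_nil memv0 big_nil => /eqP.
move=> /andP[/=/andP[/eqP bu ae] /andP[/andP[/allP ue _] oe]] x.
have {}ue y : y \in <<e>>%VS -> b u y = 0.
  move=> /(IH (introT andP (conj ae oe)))->; rewrite linear_sumr big_seq big1//.
  by move=> w /ue /= /eqP uw; rewrite linearZr_LR/= uw mulr0.
rewrite span_cons => /memv_addP[_ /vlineP[k ->] [y ye ->]].
rewrite big_cons linearDl/= linearZl_LR/= bu mulr1 dotC ue// addr0.
congr (_ + _); rewrite {1}(IH (introT andP (conj ae oe)) _ ye).
rewrite [LHS]big_seq [RHS]big_seq; apply: eq_bigr => w we.
by rewrite linearDl/= linearZl_LR/= ue ?memv_span// mulr0 add0r.
Qed.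

Lemma eq_orthonormal_trace e f (Q : g -> g -> R) :
  (forall x, scalar (Q x)) -> (forall x, scalar (Q^~ x)) ->
  orthonormal_basis e -> orthonormal_basis f ->
  \sum_(u <- e) Q u u = \sum_(u <- f) Q u u.
Proof.
move=> Qr Ql eb fb.
have Qsr x s (a : g -> R) :
    Q x (\sum_(v <- s) a v *: v) = \sum_(v <- s) a v * Q x v.
  elim: s => [|v s IH]; last by rewrite !big_cons Qr IH.
  rewrite !big_nil.
  by have := Qr x (-1) 0 0; rewrite scaler0 addr0 mulN1r addNr.
have Qsl x s (a : g -> R) :
    Q (\sum_(v <- s) a v *: v) x = \sum_(v <- s) a v * Q v x.
  elim: s => [|v s IH]; last by rewrite !big_cons Ql IH.
  rewrite !big_nil.
  by have := Ql x (-1) 0 0; rewrite scaler0 addr0 mulN1r addNr.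
rewrite (eq_bigr (fun u => \sum_(v <- f) b u v * Q v u)); last first.
  by move=> u _; rewrite {1}(orthonormal_sum u fb) Qsl.
rewrite exchange_big/=; apply: eq_bigr => v _.
transitivity (Q v (\sum_(u <- e) b v u *: u)); last by rewrite -orthonormal_sum.
rewrite Qsr.
by apply: eq_bigr => u _; rewrite dotC.
Qed.

End InnerProduct.

Section LeftInvariantMetric.
Context (R : realType) (g : lieAlgType R) (b : {dot g for idfun}).
Implicit Types (V W X Y Z : g) (s : {vspace g}) (e : seq g).

(* The symmetric bilinear map U, given by its Riesz representative; metricUE
   shows that the defining equation has a solution, unique by dot_inj. *)
Definition metricU V W : g :=
  xget 0 [set u | forall Z, b u Z = 2^-1 * (b V (lie Z W) + b W (lie Z V))].

Lemma metricUE V W Z :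
  b (metricU V W) Z = 2^-1 * (b V (lie Z W) + b W (lie Z V)).
Proof.
rewrite /metricU; case: xgetP => [u _ -> //|/= noU]; exfalso.
have [e eb] := orthonormal_basis_ex b.
apply: (noU (\sum_(u <- e) (2^-1 * (b V (lie u W) + b W (lie u V))) *: u)).
move=> Y; rewrite [in RHS](orthonormal_sum Y eb).
rewrite !linear_sumlz !linear_sumr -big_split/= mulr_sumr.
apply: eq_bigr => u _; rewrite !linearZl_LR/= !linearZr_LR/=.
by rewrite (dotC b Y); ring.
Qed.

Definition curvK X Y : R :=
  b (metricU X Y) (metricU X Y) - b (metricU X X) (metricU Y Y)
  - 3 / 4 * b (lie X Y) (lie X Y)
  - 1 / 2 * b (lie X (lie X Y)) Y - 1 / 2 * b (lie Y (lie Y X)) X.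

Definition sqnorm_wedge X Y : R := b X X * b Y Y - b X Y ^+ 2.

(* Meant for \dim s = 2; sectionalE shows that any basis of s gives the same
   value. *)
Definition sectional s : R :=
  let X := (vbasis s)`_0 in let Y := (vbasis s)`_1 in
  curvK X Y / sqnorm_wedge X Y.

(* This expression computes the Ricci curvature of the left-invariant metric
   only for nilpotent g: in general there are further terms, involving the
   Killing form and the traces of the adjoint maps. *)
Definition ricci_onb e X : R :=
  1 / 4 * (\sum_(u <- e) \sum_(v <- e) b X (lie u v) ^+ 2)
  - 1 / 2 * (\sum_(u <- e) b (lie X u) (lie X u)).

(* An orthonormal basis exists by orthonormal_basis_ex, and the choice is
   immaterial by ricciE. *)
Definition ricci X : R := ricci_onb (xget [::] [set e | orthonormal_basis b e]) X.

Lemma metricUC X Y : metricU X Y = metricU Y X.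
Proof. by apply: (dot_inj (b := b)) => Z; rewrite !metricUE addrC. Qed.

Lemma metricUDl X Y Z : metricU (X + Y) Z = metricU X Z + metricU Y Z.
Proof.
apply: (dot_inj (b := b)) => T.
by rewrite dotDl !metricUE dotDl lieDr dotDr; ring.
Qed.

Lemma metricUZl a X Z : metricU (a *: X) Z = a *: metricU X Z.
Proof.
apply: (dot_inj (b := b)) => T.
by rewrite dotZl !metricUE dotZl lieZr dotZr; ring.
Qed.

Lemma metricUDr X Y Z : metricU Z (X + Y) = metricU Z X + metricU Z Y.
Proof. by rewrite ![metricU Z _]metricUC metricUDl. Qed.

Lemma metricUZr a X Z : metricU Z (a *: X) = a *: metricU Z X.
Proof. by rewrite ![metricU Z _]metricUC metricUZl. Qed.

Lemma curvK_basis_change (p q r t : R) X Y :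
  curvK (p *: X + q *: Y) (r *: X + t *: Y) =
  (p * t - q * r) ^+ 2 * curvK X Y.
Proof.
rewrite /curvK !(metricUDl, metricUDr, metricUZl, metricUZr).
rewrite (metricUC Y X) !(lieDl, lieDr, lieZl, lieZr) !liexx (lieC Y X).
rewrite !(lieDl, lieDr, lieZl, lieZr, lieNr, scaler0, addr0, add0r).
rewrite !lie0r !(dot0l, dotDl, dotDr, dotZl, dotZr, dotNl, dotNr).
rewrite (dotC b (metricU Y Y)) !(dotC b (metricU X Y) (metricU X X)).
rewrite !(dotC b (metricU Y Y) (metricU X Y)).
by ring.
Qed.

Lemma sqnorm_wedge_basis_change (p q r t : R) X Y :
  sqnorm_wedge (p *: X + q *: Y) (r *: X + t *: Y) =
  (p * t - q * r) ^+ 2 * sqnorm_wedge X Y.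
Proof.
rewrite /sqnorm_wedge !(dotDl, dotDr, dotZl, dotZr) (dotC b Y X).
by ring.
Qed.

Lemma sectionalE s X Y :
  basis_of s [:: X; Y] -> sectional s = curvK X Y / sqnorm_wedge X Y.
Proof.
move=> sXY; have ds : \dim s = 2%N by rewrite (size_basis (X := [tuple X; Y])).
rewrite /sectional; set X' := _`_0; set Y' := _`_1.
have Es : s = <<[:: X'; Y']>>%VS.
  rewrite -[LHS](span_basis (vbasisP s)) /X' /Y'.
  have : size (vbasis s) = 2%N by rewrite size_tuple.
  by case: (tval (vbasis s)) => [|u [|v [|w l]]].
have mem2 (x : g) : x \in s -> exists k l, x = k *: X' + l *: Y'.
  rewrite Es span_cons span_seq1.
  by move=> /memv_addP[_ /vlineP[k ->] [_ /vlineP[l ->] ->]]; exists k, l.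
have [|p [q EX]] := mem2 X; first by rewrite (basis_mem sXY)// inE eqxx.
have [|r [t EY]] := mem2 Y; first by rewrite (basis_mem sXY)// !inE eqxx orbT.
have D0 : p * t - q * r != 0.
  apply: contraTneq (basis_free sXY) => /eqP; rewrite subr_eq0 => /eqP D.
  rewrite free_cons span_seq1 seq1_free negb_and negbK negbK.
  have [t0|t0] := eqVneq t 0; last first.
    apply/orP; left; apply/vlineP; exists (q / t); rewrite EX EY.
    by rewrite scalerDr !scalerA divfK// mulrAC -D mulfK.
  have [r0|r0] := eqVneq r 0; last first.
    apply/orP; left; apply/vlineP; exists (p / r); rewrite EX EY.
    by rewrite scalerDr !scalerA divfK// mulrAC D mulfK.
  by rewrite EY t0 r0 !scale0r addr0 eqxx orbT.
rewrite EX EY curvK_basis_change sqnorm_wedge_basis_change.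
by rewrite -mulf_div divff ?mul1r// sqrf_eq0.
Qed.

Lemma ricciE e X : orthonormal_basis b e -> ricci X = ricci_onb e X.
Proof.
move=> eb; rewrite /ricci; case: xgetP => [f _ fb|/= nob]; last first.
  by have [f /nob] := orthonormal_basis_ex b.
have trE := @eq_orthonormal_trace _ _ b f e.
rewrite /ricci_onb; congr (_ * _ - _ * _); last first.
  apply: (trE (fun u v => b (lie X u) (lie X v))) => // x a u v.
    by rewrite lieDr lieZr dotDr dotZr.
  by rewrite lieDr lieZr dotDl dotZl.
rewrite (eq_bigr (fun u => \sum_(v <- e) b X (lie u v) ^+ 2)); last first.
  move=> u _; apply: (trE (fun v w => b X (lie u v) * b X (lie u w))) => //.
    by move=> v a w x; rewrite lieDr lieZr dotDr dotZr; ring.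
  by move=> v a w x; rewrite lieDr lieZr dotDr dotZr; ring.
rewrite exchange_big [RHS]exchange_big/=; apply: eq_bigr => v _.
apply: (trE (fun u w => b X (lie u v) * b X (lie w v))) => //.
  by move=> u a w x; rewrite lieDl lieZl dotDr dotZr; ring.
by move=> u a w x; rewrite lieDl lieZl dotDr dotZr; ring.
Qed.

End LeftInvariantMetric.

Section CurvatureSets.
Context (R : realType) (g : lieAlgType R).
Implicit Types (A : set g) (S : set R).

Definition grassmannian2 A : set {vspace g} :=
  [set s | \dim s = 2%N /\ [set` s] `<=` A].

Definition ricci_always S : set g :=
  [set X | forall b : {dot g for idfun}, S (ricci b X)].

Definition sectional_always S : set {vspace g} :=
  [set s | grassmannian2 setT s /\
    forall b : {dot g for idfun}, S (sectional b s)].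

Definition parallel (U V : g) := ~~ free [:: U; V].

Definition span_planes (P : g -> g -> Prop) : set {vspace g} :=
  [set s | exists X Y, basis_of s [:: X; Y] /\ P X Y].

End CurvatureSets.
Arguments lie_abelian {R} g.
Arguments lie_nilpotent {R} g.
Arguments lie_center {R} g.
Arguments lie_derived {R} g.
Arguments ricci_always {R} g S.
Arguments sectional_always {R} g S.
Arguments grassmannian2 {R g} A.

(* Main.v *)
(* A curvature is made to take a given strict sign by rescaling one unit vector
   z of a suitable inner product by a factor s, i.e. by adding
   (s^2 - 1) <., z>^2 to the inner product.
   - If X is not central, W = [X, Y] <> 0, then making W long makes Ric(X)
     negative. If X <> 0 and <X, [U, V]> <> 0 with X, U, V orthonormal, then
     making X long makes Ric(X) positive.
   - If z is orthogonal to X and Y, then shrinking z gives K(X, Y) the sign of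
       (1/2 (<X, [z, Y]> + <Y, [z, X]>))^2 - <X, [z, X]> <Y, [z, Y]>,
     which is minus the determinant of the symmetric part of the form
     <v, [z, w]> on Span(X, Y), provided that this quantity is nonzero; for
     [X, Y] <> 0, lengthening [X, Y] makes K(X, Y) negative.
   Nilpotency makes enough of the vectors involved linearly independent for the
   functionals <X, .> and <Y, .> to be prescribed as needed.
   For a plane s with K >= 0 for all metrics, the maps ad Z restricted to s have
   rank at most one, so they have a common kernel or a common image line. In the
   latter case a metric for which that line is orthogonal to s gives K = 0; in
   the former, s contains a central X, and K = 0 for some metric unless X lies
   in [Y, g]. *)
From HB Require Import structures.
Require Import Defs.
From mathcomp Require Import all_boot all_order all_algebra ring lra.
From mathcomp Require Import boolp classical_sets reals.

Import Order.TTheory GRing.Theory Num.Theory.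
Local Open Scope classical_set_scope.
Local Open Scope ring_scope.

(** * Inner products with prescribed functionals; orthonormal completion *)

Section InnerProducts.
Context {R : realType} {g : vectType R}.
Implicit Types (b : {dot g for idfun}) (x y z u v : g) (e : seq g) (f : g -> R).

Lemma dot_ex (q : g -> g -> R) : (forall v, scalar (q^~ v)) ->
    (forall u v, q u v = q v u) -> (forall u, u != 0 -> 0 < q u u) ->
  exists b : {dot g for idfun}, forall u v, b u v = q u v.
Proof.
move=> ql qC q0.
have qr u : linear_for (idfun \; *%R) (q u).
  by move=> a v w; rewrite !(qC u) ql.
have qH u v : q u v = (-1) ^+ false * idfun (q v u) by rewrite mul1r qC.
pose qM := bilinear_isBilinear.Build R g g R *%R (idfun \; *%R) q (pair ql qr).
pose hM := isHermitianSesquilinear.Build R g false idfun q qH.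
pose dM := isDotProduct.Build R g q q0.
pose qb : {dot g for idfun} := HB.pack_for (@Dot.type R g idfun) q qM hM dM.
by exists qb.
Qed.

(** The form is the one for which a chosen basis is orthonormal. *)
Lemma dot_nonempty : exists b : {dot g for idfun}, True.
Proof.
pose c i u := coord (vbasis (@fullv R g)) i u.
have [||u u0|b _] := @dot_ex (fun u v => \sum_i c i u * c i v); last by exists b.
- move=> v a u w; rewrite mulr_sumr -big_split; apply: eq_bigr => i _.
  by rewrite /c linearP /= mulrDl mulrA.
- by move=> u v; apply: eq_bigr => i _; rewrite mulrC.
rewrite lt_def sumr_ge0 ?andbT => [|i _]; last by rewrite -expr2 sqr_ge0.
apply: contraNneq u0 => /eqP.
rewrite psumr_eq0 => [|i _]; last by rewrite -expr2 sqr_ge0.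
move=> /allP c0; rewrite (coord_vbasis (memvf u)) big1// => i _.
have := c0 i (mem_index_enum _); rewrite -expr2 sqrf_eq0 -/(c i u) => /eqP.
by rewrite /c => ->; rewrite scale0r.
Qed.

Lemma dot_gt0 b u : u != 0 -> 0 < b u u.
Proof. exact: neq0_dnorm_gt0. Qed.

(* The new form makes x a unit vector whose orthogonal complement is the kernel
   of f, and keeps b on that kernel. *)
Lemma dot_set b x f : scalar f -> f x = 1 ->
  exists b' : {dot g for idfun}, (forall v, b' x v = f v) /\
    forall u v, f u = 0 -> b' u v = b u (v - f v *: x).
Proof.
(* [P] is the projection onto the kernel of [f] along [x]. *)
move=> fl fx; pose P u := u - f u *: x.
have PP a u v : P (a *: u + v) = a *: P u + P v.
  by rewrite /P fl scalerDl scalerBr scalerA opprD addrACA.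
have [||u u0|b' b'E] := @dot_ex (fun u v => f u * f v + b (P u) (P v)).
- by move=> v a u w; rewrite fl PP dotDl dotZl; ring.
- by move=> u v; rewrite mulrC dotC.
- rewrite lt_def -expr2 addr_ge0 ?sqr_ge0 ?dot_ge0// andbT.
  rewrite paddr_eq0 ?sqr_ge0 ?dot_ge0// sqrf_eq0 dot_eq0.
  apply: contraNN u0 => /andP[/eqP fu].
  by rewrite /P fu scale0r subr0.
exists b'; split=> [v|u v fu]; rewrite b'E.
  by rewrite fx mul1r /P fx scale1r subrr dot0l addr0.
by rewrite fu mul0r add0r /P fu scale0r subr0.
Qed.

Lemma free_functional (X : seq g) (c : seq R) : free X -> size c = size X ->
  exists2 f, scalar f & map f X = c.
Proof.
move=> Xf cX; have [f fE] := linear_of_free (rT := R^o) X c.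
by exists f; [exact: linearP|exact: fE].
Qed.

Lemma scalar_morph f : scalar f ->
  [/\ f 0 = 0, {morph f : u v / u + v}, {morph f : u / - u} &
      forall a u, f (a *: u) = a * f u].
Proof.
move=> fl.
have f0 : f 0 = 0 by have := fl (-1) 0 0; rewrite scaler0 addr0 mulN1r addNr.
have fZ a u : f (a *: u) = a * f u by rewrite -[a *: u]addr0 fl f0 addr0.
split=> // [u v|u]; first by rewrite -[u in LHS]scale1r fl mul1r.
by rewrite -scaleN1r fZ mulN1r.
Qed.

Lemma separating_functional x (V : {vspace g}) : x \notin V ->
  exists2 f, scalar f & f x = 1 /\ {in V, forall v, f v = 0}.
Proof.
move=> xV.
have xF : free (x :: vbasis V).
  by rewrite free_cons (span_basis (vbasisP V)) xV (basis_free (vbasisP V)).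
have [|f fl /=[fx f0]] := free_functional (x :: vbasis V)
   (1 :: nseq (\dim V) 0) xF; first by rewrite /= size_nseq size_tuple.
exists f => //; split=> // v /coord_vbasis ->.
have [f00 fD _ fZ] := scalar_morph f fl.
have : {in vbasis V, forall u, f u = 0}.
  move=> u uV; have : f u \in map f (vbasis V) by exact: map_f.
  by rewrite f0 => /nseqP[].
move=> fV; elim/big_rec: _ => // i w _ fw; rewrite fD fZ fw fV ?mulr0 ?addr0//.
by rewrite mem_nth// size_tuple.
Qed.

(** [dot_set] is applied to [z], then [y], then [x]. Each application keeps what the earlier ones
    achieved, because [fx] vanishes at [y] and [z], and [fy] at [x] and [z]. *)
Lemma dot_set2 x y z (fx fy : g -> R) : scalar fx -> scalar fy -> z != 0 ->
    map fx [:: x; y; z] = [:: 1; 0; 0] -> map fy [:: x; y; z] = [:: 0; 1; 0] ->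
  exists b : {dot g for idfun},
    [/\ forall v, b x v = fx v, forall v, b y v = fy v & b z z = 1].
Proof.
move=> fxl fyl z0 [xx xy xz] [yx yy yz].
have [_ fyD fyN fyZ] := scalar_morph fy fyl.
have [b0 _] := dot_nonempty.
have [fz fzl [zz]] : exists2 fz, scalar fz & map fz [:: z] = [:: 1].
  by apply: free_functional; rewrite // seq1_free.
have [b1 [b1z b1E]] := dot_set b0 z fz fzl zz.
have [b2 [b2y b2E]] := dot_set b1 y fy fyl yy.
have [b3 [b3x b3E]] := dot_set b2 x fx fxl xx.
exists b3; split=> // [v|].
  by rewrite b3E// b2y fyD fyN fyZ yx mulr0 subr0.
by rewrite b3E// xz scale0r subr0 b2E// yz scale0r subr0 b1z.
Qed.

Lemma orthonormal_cons b u e : orthonormal b (u :: e) ->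
  [/\ b u u = 1, {in <<e>>%VS, forall v, b u v = 0} & orthonormal b e].
Proof.
move=> /andP[/=/andP[/eqP bu e1] /andP[/andP[/allP ue _] oe]].
split; [by []| |by rewrite /orthonormal e1 oe].
rewrite -[e]in_tupleE => v /coord_span ->.
rewrite linear_sumr big1 // => i _; rewrite linearZr_LR /=.
by have /eqP -> := ue _ (mem_nth 0 (ltn_ord i)); rewrite mulr0.
Qed.

Lemma orthonormal_consI b u e : b u u = 1 -> {in e, forall v, b u v = 0} ->
  orthonormal b e -> orthonormal b (u :: e).
Proof.
move=> bu ue /andP[e1 oe]; apply/andP; split => /=; first by rewrite bu eqxx.
by rewrite oe !andbT; apply/allP => v /ue /= ->.
Qed.

Lemma dot_orthonormal_free b e : orthonormal b e -> free e.
Proof.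
elim: e => [_|u e IH /orthonormal_cons[bu ue /IH ef]]; first exact: nil_free.
rewrite free_cons ef andbT; apply: contra_eqN bu => /ue ->.
by rewrite eq_sym oner_neq0.
Qed.

Lemma orthonormal_proj b e u : orthonormal b e ->
  exists2 p, p \in <<e>>%VS & {in e, forall v, b (u - p) v = 0}.
Proof.
elim: e => [_|v e IH /orthonormal_cons[bv ve /IH[p pe up]]].
  by exists 0 => //; rewrite mem0v.
exists (b u v *: v + p).
  by rewrite span_cons memv_add// memvZ// memv_line.
move=> w; rewrite inE => /predU1P[->|we].
  by rewrite opprD addrCA dotDl dotNl dotZl bv dotDl dotNl (dotC b p) ve//; ring.
by rewrite opprD addrCA dotDl dotNl dotZl ve ?memv_span// up//; ring.
Qed.

Lemma orthonormal_complete b e : orthonormal b e ->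
  exists r, orthonormal_basis b (e ++ r).
Proof.
move=> oe; have [r [_ re or]] := orthonormal_span b (orthov b <<e>>).
have oer : orthonormal b (e ++ r).
  have : {in e & r, forall u v, b u v = 0}.
    move=> u v ue vr; have : v \in orthov b <<e>> by rewrite -re memv_span.
    by move=> /mem_orthovP vu; rewrite dotC vu// memv_span.
  elim: {re} e oe => //= u e IH /orthonormal_cons[bu ue oe] er.
  apply: orthonormal_consI => //; last first.
    by apply: IH => // v w ve wr; rewrite er// inE ve orbT.
  move=> v; rewrite mem_cat => /orP[ve|vr]; last by rewrite er ?mem_head.
  by rewrite ue// memv_span.
exists r; rewrite /orthonormal_basis oer andbT.
rewrite basisEfree (dot_orthonormal_free _ _ oer) subvf /=.
have -> : fullv = <<e ++ r>>%VS; last by rewrite dim_span.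
apply/esym/eqP; rewrite eqEsubv subvf; apply/subvP => u _.
have [p pe up] := orthonormal_proj b e u oe.
rewrite -[u](subrK p) addrC span_cat memv_add// re; apply/mem_orthovP.
rewrite -[e]in_tupleE => v /coord_span ->.
rewrite linear_sumr big1 // => i _; rewrite linearZr_LR /=.
by rewrite up ?mulr0// mem_nth.
Qed.

End InnerProducts.

(** * Stretching an inner product along one unit vector *)

Section Rescaling.
Context {R : realType} {g : vectType R}.
Implicit Types (b : {dot g for idfun}) (u v z : g) (e r : seq g) (s : R).

Lemma parseval b e u v : orthonormal_basis b e ->
  b u v = \sum_(w <- e) b u w * b v w.
Proof.
move=> eb; rewrite {1}(orthonormal_sum u eb) linear_sumlz.
by apply: eq_bigr => w _; rewrite linearZl_LR /= (dotC b w).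
Qed.

Lemma orthonormal_size b e :
  orthonormal_basis b e = orthonormal b e && (size e == \dim {:g}).
Proof.
apply/idP/idP => [/andP[eb ->]|/andP[oe /eqP se]].
  by rewrite -(size_basis (X := in_tuple e) eb) eqxx.
rewrite /orthonormal_basis oe andbT basisEfree subvf se leqnn.
by rewrite (dot_orthonormal_free _ _ oe).
Qed.

Lemma bessel1 b z u : b z z = 1 -> b u z ^+ 2 <= b u u.
Proof.
move=> bz; have := dot_ge0 b (u - b u z *: z).
rewrite dotDl dotNl !(dotDr, dotNr, dotZl, dotZr) bz (dotC b z).
by move=> ?; nra.
Qed.

(** When [z] is a unit vector for [b], its length becomes [|s|], while its orthogonal complement is
    left as it was. This is a relation, since positivity of the new form depends on [z] and [s]. *)
Definition rescaled b z s (b' : {dot g for idfun}) :=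
  forall u v, b' u v = b u v + (s ^+ 2 - 1) * (b u z * b v z).

Lemma rescale_ex b z s : b z z = 1 -> s != 0 -> exists b', rescaled b z s b'.
Proof.
move=> bz s0; apply: dot_ex.
- by move=> v a u w; rewrite !(dotDl, dotZl); ring.
- by move=> u v; rewrite dotC; ring.
(* The new square length of [u] is [(b u u - b u z ^+ 2) + (s * b u z) ^+ 2]. The first summand is
   nonnegative by [bessel1]; the second is positive unless [b u z = 0], when [b u u] remains. *)
move=> u u0; have := bessel1 b z u bz.
have : 0 <= (s * b u z) ^+ 2 by rewrite sqr_ge0.
have [c0|c0] := eqVneq (b u z) 0.
  by rewrite c0 !(mul0r, mulr0, addr0) dot_gt0.
have : (s * b u z) ^+ 2 != 0 by rewrite sqrf_eq0 mulf_neq0.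
by move=> n0; rewrite le_eqVlt eq_sym (negPf n0) /= => ? ?; nra.
Qed.

Lemma rescaled_basis b z s b' r : s != 0 -> rescaled b z s b' ->
  orthonormal_basis b (z :: r) -> orthonormal_basis b' (s^-1 *: z :: r).
Proof.
move=> s0 b'E; rewrite !orthonormal_size => /andP[/orthonormal_cons[bz zr or]].
move=> /= ->; rewrite andbT.
have zr' v : v \in r -> b z v = 0 by move=> vr; rewrite zr// memv_span.
apply: orthonormal_consI.
- by rewrite b'E !(dotZl, dotZr) bz; field.
- by move=> v vr; rewrite b'E !dotZl (dotC b v) zr'//; ring.
elim: r or zr' {zr} => //= v r IH /orthonormal_cons[bv vr or] zr.
have vz : b v z = 0 by rewrite dotC zr ?mem_head.
apply: orthonormal_consI.
- by rewrite b'E vz bv; ring.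
- by move=> w wr; rewrite b'E vz vr ?memv_span//; ring.
by apply: IH => // w wr; rewrite zr// inE wr orbT.
Qed.

End Rescaling.

(** * Effect of a rescaling on sectional and Ricci curvature *)

Section CurvatureRescaling.
Context {R : realType} {g : lieAlgType R}.
Implicit Types (b : {dot g for idfun}) (u v z X Y : g) (e r : seq g) (s : R).

(* The contribution of a unit vector z to |U(X,Y)|^2 - <U(X,X), U(Y,Y)>. *)
Definition curvU b X Y z : R :=
  (2^-1 * (b X (lie z Y) + b Y (lie z X))) ^+ 2
  - b X (lie z X) * b Y (lie z Y).

Lemma curvKE b e X Y : orthonormal_basis b e ->
  curvK b X Y = \sum_(z <- e) curvU b X Y z
    - 3 / 4 * b (lie X Y) (lie X Y)
    - 1 / 2 * b (lie X (lie X Y)) Y - 1 / 2 * b (lie Y (lie Y X)) X.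
Proof.
move=> eb; rewrite /curvK !(parseval b e (metricU b _ _) _ eb) -sumrB.
congr (_ - _ - _ - _); apply: eq_bigr => z _.
by rewrite !metricUE /curvU; field.
Qed.

(** As [z] is orthogonal to [X] and [Y], pairings with [X] and [Y] do not change. In an orthonormal
    basis through [z], only the summand of [z], now taken at [s^-1 *: z], and the square length of
    [lie X Y] are affected. *)
Lemma curvK_rescale b z s b' X Y : b z z = 1 -> s != 0 -> rescaled b z s b' ->
    b X z = 0 -> b Y z = 0 ->
  curvK b' X Y = curvK b X Y + (s^-1 ^+ 2 - 1) * curvU b X Y z
    - 3 / 4 * (s ^+ 2 - 1) * b (lie X Y) z ^+ 2.
Proof.
move=> bz s0 b'E Xz Yz.
have [|r eb] := orthonormal_complete b [:: z].
  by rewrite /orthonormal /= bz eqxx.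
rewrite (curvKE _ _ _ _ eb) (curvKE _ _ _ _ (rescaled_basis _ _ _ _ _ s0 b'E eb)).
have bX v : b' X v = b X v by rewrite b'E Xz; ring.
have bY v : b' Y v = b Y v by rewrite b'E Yz; ring.
have UE v : curvU b' X Y v = curvU b X Y v by rewrite /curvU !bX !bY.
rewrite /= !big_cons (eq_bigr (curvU b X Y)) => [|v _]; last exact: UE.
have -> : curvU b' X Y (s^-1 *: z) = s^-1 ^+ 2 * curvU b X Y z.
  by rewrite UE /curvU !lieZl !dotZr; ring.
by rewrite !b'E Xz Yz; ring.
Qed.

Lemma quadratic_gt0 (a c : R) : 0 < c ->
  exists2 t : R, 1 <= t & 0 < a + (t ^+ 2 - 1) * c.
Proof.
move=> c0; pose d := `|a| / c.
have dc : d * c = `|a| by rewrite divfK// gt_eqF.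
have d0 : 0 <= d by rewrite divr_ge0 ?normr_ge0// ltW.
(* Here [t ^+ 2 - 1] is [3 + 4 * d + d ^+ 2], which exceeds [d]. *)
exists (2 + d); first by lra.
by have := ler_norm (- a); rewrite normrN -dc => ?; nra.
Qed.

Lemma ler_term_sum (T : eqType) (e : seq T) (x : T) (F : T -> R) : x \in e ->
  (forall y, 0 <= F y) -> F x <= \sum_(y <- e) F y.
Proof. by move=> xe F0; rewrite (big_rem x)//= lerDl sumr_ge0. Qed.

(** Shrinking [z] by the factor [t^-1] multiplies the [curvU] term by [t ^+ 2]; the term in
    [lie X Y] can then only raise the curvature. *)
Lemma curvK_pos_ex b X Y z : b z z = 1 -> b X z = 0 -> b Y z = 0 ->
  0 < curvU b X Y z -> exists b' : {dot g for idfun}, 0 < curvK b' X Y.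
Proof.
move=> bz Xz Yz U0; have [t t1 Kt] := quadratic_gt0 (curvK b X Y) _ U0.
have t0 : t != 0 by apply: contraTneq t1 => ->; rewrite -ltNge ltr01.
have [|b' b'E] := rescale_ex b z t^-1 bz; first by rewrite invr_eq0.
exists b'; rewrite (curvK_rescale _ _ _ _ _ _ bz _ b'E)// ?invr_eq0// invrK.
have t2 : t^-1 ^+ 2 <= 1.
  by rewrite exprVn invf_le1 ?exprn_gt0 ?(lt_le_trans ltr01 t1)// exprn_ege1.
have := sqr_ge0 (b (lie X Y) z); nra.
Qed.

(** Shrinking [z] again; the term in [lie X Y], which would now have the wrong sign, vanishes. *)
Lemma curvK_neg_ex b X Y z : b z z = 1 -> b X z = 0 -> b Y z = 0 ->
    lie X Y = 0 -> curvU b X Y z < 0 ->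
  exists b' : {dot g for idfun}, curvK b' X Y < 0.
Proof.
move=> bz Xz Yz XY U0; have U0' : 0 < - curvU b X Y z by rewrite oppr_gt0.
have [t t1 Kt] := quadratic_gt0 (- curvK b X Y) _ U0'.
have t0 : t != 0 by apply: contraTneq t1 => ->; rewrite -ltNge ltr01.
have [|b' b'E] := rescale_ex b z t^-1 bz; first by rewrite invr_eq0.
exists b'; rewrite (curvK_rescale _ _ _ _ _ _ bz _ b'E)// ?invr_eq0// invrK.
rewrite XY dot0l; lra.
Qed.

(** Lengthening [z] makes the term in [lie X Y] arbitrarily negative, while the [curvU] term changes
    by at most [|curvU b X Y z|]. *)
Lemma curvK_neg_lie_ex b X Y z : b z z = 1 -> b X z = 0 -> b Y z = 0 ->
  b (lie X Y) z != 0 -> exists b' : {dot g for idfun}, curvK b' X Y < 0.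
Proof.
move=> bz Xz Yz W0; have W0' : 0 < 3 / 4 * b (lie X Y) z ^+ 2.
  by rewrite mulr_gt0 ?divr_gt0// exprn_even_gt0.
pose U := `|curvU b X Y z|.
have [t t1 Kt] := quadratic_gt0 (- curvK b X Y - U) _ W0'.
have t0 : t != 0 by apply: contraTneq t1 => ->; rewrite -ltNge ltr01.
have [b' b'E] := rescale_ex b z t bz t0.
exists b'; rewrite (curvK_rescale _ _ _ _ _ _ bz t0 b'E)//.
have t2 : 0 <= 1 - t^-1 ^+ 2 <= 1.
  rewrite subr_ge0 gerBl sqr_ge0 andbT.
  by rewrite exprVn invf_le1 ?exprn_gt0 ?(lt_le_trans ltr01 t1)// exprn_ege1.
have := ler_norm (- curvU b X Y z); rewrite normrN -/U.
have U0 : 0 <= U by exact: normr_ge0.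
nra.
Qed.

(** When [X] is stretched by [t], the positive part of the Ricci curvature grows at least like
    [t ^+ 4], through the pair [u], [v], and the negative part at most like [t ^+ 2]. *)
Lemma ricci_pos_ex b X u v : b X X = 1 -> b u u = 1 -> b v v = 1 ->
    b X u = 0 -> b X v = 0 -> b u v = 0 -> b X (lie u v) != 0 ->
  exists b' : {dot g for idfun}, 0 < ricci b' X.
Proof.
move=> bX bu bv Xu Xv uv W0.
have [|r eb] := orthonormal_complete b [:: X; u; v].
  by rewrite /orthonormal /= bX bu bv Xu Xv uv !eqxx.
pose c : R := \sum_(w <- [:: u, v & r]) b (lie X w) (lie X w).
have W0' : 0 < 1 / 4 * b X (lie u v) ^+ 2.
  by rewrite mulr_gt0 ?divr_gt0// exprn_even_gt0.
(* Including the leading coefficient in the constant term turns [t ^+ 2 - 1] into [t ^+ 2]. *)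
have [t t1 ct] := quadratic_gt0 (1 / 4 * b X (lie u v) ^+ 2 - 1 / 2 * c) _ W0'.
have tg0 : 0 < t by apply: lt_le_trans t1.
have [b' b'E] := rescale_ex b X t bX (lt0r_neq0 tg0).
exists b'; have e'b := rescaled_basis _ _ _ _ _ (lt0r_neq0 tg0) b'E eb.
rewrite (ricciE _ e'b) /ricci_onb.
have S1 : (t ^+ 2 * b X (lie u v)) ^+ 2 <=
    \sum_(x <- t^-1 *: X :: [:: u, v & r])
      \sum_(y <- t^-1 *: X :: [:: u, v & r]) b' X (lie x y) ^+ 2.
  apply: (le_trans _ (ler_term_sum _ _ u _ _ _)) => [||x]; last 2 first.
  - by rewrite !inE eqxx orbT.
  - by rewrite sumr_ge0 // => y _; exact: sqr_ge0.
  apply: (le_trans _ (ler_term_sum _ _ v _ _ _)) => [||y]; last 2 first.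
  - by rewrite !inE eqxx !orbT.
  - exact: sqr_ge0.
  by rewrite b'E bX (dotC b _ X) le_eqVlt; apply/orP; left; apply/eqP; ring.
have S2 : \sum_(w <- t^-1 *: X :: [:: u, v & r]) b' (lie X w) (lie X w)
    <= t ^+ 2 * c.
  rewrite /= big_cons lieZr liexx scaler0 dot0l add0r /c.
  rewrite mulr_sumr ler_sum// => w _; rewrite b'E.
  by have := bessel1 b X (lie X w) bX; have := exprn_ege1 2 t1; nra.
have t2 := exprn_ege1 2 t1.
set A := \sum_(_ <- _) _ in S1 *; set B := \sum_(_ <- _) _ in S2 *.
have : 0 < t ^+ 2 * (t ^+ 2 * (1 / 4 * b X (lie u v) ^+ 2) - 1 / 2 * c).
  by rewrite mulr_gt0 ?exprn_gt0//; lra.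
by rewrite exprMn in S1; nra.
Qed.

(** When [W] is stretched by [t], the positive part stays bounded: pairings with [X] do not change,
    and brackets with [t^-1 *: W] only shrink. The basis vector [Y] contributes [t ^+ 2] to the
    negative part. *)
Lemma ricci_neg_ex b X Y : b X (lie X Y) = 0 -> b Y Y = 1 ->
    b (lie X Y) (lie X Y) = 1 -> b Y (lie X Y) = 0 ->
  exists b' : {dot g for idfun}, ricci b' X < 0.
Proof.
set W := lie X Y => XW bY bW YW.
have [|r eb] := orthonormal_complete b [:: W; Y].
  by rewrite /orthonormal /= bY bW (dotC b W) YW !eqxx.
pose F z := \sum_(v <- Y :: r) b X (lie z v) ^+ 2.
(* [F W] is counted twice because [W] can occupy either slot of the bracket. *)
pose c : R := 1 / 4 * (2 * F W + \sum_(z <- Y :: r) F z).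
have W0 : 0 < 1 / 2 :> R by rewrite divr_gt0.
have [t t1 ct] := quadratic_gt0 (- c) _ W0.
have tg0 : 0 < t by apply: lt_le_trans t1.
have [b' b'E] := rescale_ex b W t bW (lt0r_neq0 tg0).
exists b'; have e'b := rescaled_basis _ _ _ _ _ (lt0r_neq0 tg0) b'E eb.
rewrite (ricciE _ e'b) /ricci_onb.
have t2 : t^-1 ^+ 2 <= 1 by rewrite exprVn invf_le1 ?exprn_gt0// exprn_ege1.
have S1 : \sum_(x <- t^-1 *: W :: Y :: r)
      \sum_(y <- t^-1 *: W :: Y :: r) b' X (lie x y) ^+ 2 <= 4 * c.
  have b'X v : b' X v = b X v by rewrite b'E XW; ring.
  rewrite (eq_bigr (fun x => \sum_(y <- t^-1 *: W :: Y :: r) b X (lie x y) ^+ 2));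
    last by move=> x _; apply: eq_bigr => y _; rewrite b'X.
  rewrite big_cons [X in X + _ <= _]big_cons lieZl lieZr liexx !scaler0.
  rewrite (dotC b X 0) dot0l.
  rewrite expr0n /= add0r.
  rewrite [X in X + _ <= _](_ : _ = t^-1 ^+ 2 * F W); last first.
    rewrite mulr_sumr; apply: eq_bigr => y _.
    by rewrite lieZl dotZr exprMn.
  rewrite [X in _ + X <= _](_ : _ = t^-1 ^+ 2 * F W + \sum_(z <- Y :: r) F z).
    have : 0 <= F W by apply: sumr_ge0 => y _; exact: sqr_ge0.
    by rewrite /c => ?; nra.
  rewrite mulr_sumr -big_split; apply: eq_bigr => x _.
  rewrite big_cons /F; congr (_ + _).
  by rewrite lieZr dotZr lieC dotNr; ring.
have S2 : t ^+ 2 <= \sum_(u <- t^-1 *: W :: Y :: r) b' (lie X u) (lie X u).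
  apply: (le_trans _ (ler_term_sum _ _ Y _ _ _)) => [||y]; last 2 first.
  - by rewrite !inE eqxx orbT.
  - exact: dot_ge0.
  by rewrite b'E -/W bW le_eqVlt; apply/orP; left; apply/eqP; ring.
by nra.
Qed.

End CurvatureRescaling.

(** * Independence and spans of two or three vectors; bases of planes *)

Section SmallSpans.
Context {K : fieldType} {V : vectType K}.
Implicit Types (x y z u : V) (s : {vspace V}).

Lemma free2P x y :
  (forall a b, a *: x + b *: y = 0 -> a = 0 /\ b = 0) <-> free [:: x; y].
Proof.
split=> [H|/(freeP (X := [tuple x; y])) H a b ab0].
  apply/(freeP (X := [tuple x; y])) => k; rewrite !big_ord_recl big_ord0 addr0 /=.
  by case/H => k0 k1; case=> -[|[|]] // i; [rewrite -[RHS]k0|rewrite -[RHS]k1];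
    congr k; apply: val_inj.
have k0 := H (fun i : 'I_2 => nth 0 [:: a; b] i).
rewrite !big_ord_recl big_ord0 addr0 /= in k0.
by split; [exact: (k0 ab0 ord0)|exact: (k0 ab0 (Ordinal (isT : 1 < 2)%N))].
Qed.

Lemma free3P x y z :
  (forall a b c, a *: x + b *: y + c *: z = 0 -> [/\ a = 0, b = 0 & c = 0]) <->
  free [:: x; y; z].
Proof.
split=> [H|/(freeP (X := [tuple x; y; z])) H a b c abc0].
  apply/(freeP (X := [tuple x; y; z])) => k; rewrite !big_ord_recl big_ord0 addr0 /=.
  rewrite addrA => /H[k0 k1 k2]; case=> -[|[|[|]]] // i;
   [rewrite -[RHS]k0|rewrite -[RHS]k1|rewrite -[RHS]k2];
    congr k; apply: val_inj => //.
have k0 := H (fun i : 'I_3 => nth 0 [:: a; b; c] i).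
rewrite !big_ord_recl big_ord0 addr0 /= addrA in k0.
by split; [exact: (k0 abc0 ord0)|exact: (k0 abc0 (Ordinal (isT : 1 < 3)%N))
  |exact: (k0 abc0 (Ordinal (isT : 2 < 3)%N))].
Qed.

Lemma span2P x y u :
  reflect (exists a b, u = a *: x + b *: y) (u \in <<[:: x; y]>>%VS).
Proof.
rewrite span_cons span_seq1; apply: (iffP memv_addP).
  by move=> [_ /vlineP[a ->] [_ /vlineP[b ->] ->]]; exists a, b.
by move=> [a [b ->]]; exists (a *: x); rewrite ?memvZ ?memv_line//;
  exists (b *: y); rewrite ?memvZ ?memv_line.
Qed.

Lemma span3P x y z u :
  reflect (exists a b c, u = a *: x + b *: y + c *: z)
    (u \in <<[:: x; y; z]>>%VS).
Proof.
rewrite span_cons; apply: (iffP memv_addP).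
  move=> [_ /vlineP[a ->] [_ /span2P[b [c ->]] ->]].
  by exists a, b, c; rewrite addrA.
move=> [a [b [c ->]]]; exists (a *: x); rewrite ?memvZ ?memv_line//.
by exists (b *: y + c *: z); rewrite ?addrA//; apply/span2P; exists b, c.
Qed.

Lemma plane_basis s x y : \dim s = 2%N -> x \in s -> y \in s ->
  free [:: x; y] -> basis_of s [:: x; y].
Proof.
move=> ds xs ys xy; rewrite basisEfree xy ds leqnn andbT /=.
by apply/span_subvP => u; rewrite !inE => /orP[] /eqP ->.
Qed.

Lemma plane_completion s x : \dim s = 2%N -> x \in s -> x != 0 ->
  exists y, basis_of s [:: x; y].
Proof.
move=> ds xs x0; have /subvPn[y ys xy] : ~~ (s <= <[x]>)%VS.
  by apply: contraTN isT => /dimvS; rewrite ds dim_vline x0.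
exists y; apply: plane_basis => //.
by rewrite (perm_free (Y := [:: y; x])) ?free_cons ?span_seq1 ?xy ?nil_free
  ?span_nil ?memv0 ?x0// (perm_catC [:: x] [:: y]).
Qed.

Lemma basis2P s x y u : basis_of s [:: x; y] ->
  reflect (exists a b, u = a *: x + b *: y) (u \in s).
Proof. by move=> /span_basis <-; exact: span2P. Qed.

Lemma basis2_neq0 s x y u : basis_of s [:: x; y] -> u \in s -> u != 0 ->
  exists a b, u = a *: x + b *: y /\ ((a != 0) || (b != 0)).
Proof.
move=> sb /(basis2P _ _ _ _ sb)[a [b ->]] u0; exists a, b; split=> //.
by apply: contraNT u0; rewrite negb_or !negbK => /andP[/eqP-> /eqP->];
  rewrite !scale0r addr0.
Qed.

End SmallSpans.

(** * Independence statements forced by nilpotency *)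

Section Nilpotent.
Context {R : realType} {g : lieAlgType R} (nilp : lie_nilpotent g).
Implicit Types (u v X Y Z U W : g) (s : {vspace g}).

Lemma lower_central_sub n : (lower_central g n.+1 <= lower_central g n)%VS.
Proof.
elim: n => [|n IH]; first exact: subvf.
by apply: lieprod_sub => x y _ yn; rewrite memv_lieprod ?memvf// (subvP IH).
Qed.

(* The witness is the last term of the lower central series that contains W. *)
Lemma nilpotent_depth W : W != 0 -> exists2 I : {vspace g}, W \in I &
  forall Z U, U \in I -> lie Z U \in I /\ forall c, lie Z U = c *: W -> c = 0.
Proof.
move=> W0; have exn : exists n, W \notin lower_central g n.
  by have [n n0] := nilp; exists n; rewrite n0 memv0.
case: (ex_minnP exn) => -[|n]; first by rewrite memvf.
move=> Wn1 nmin; exists (lower_central g n).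
  by apply: contraT => /nmin; rewrite ltnn.
move=> Z U Un; have ZU : lie Z U \in lower_central g n.+1.
  by rewrite memv_lieprod// memvf.
split=> [|c ZUc]; first exact: (subvP (lower_central_sub n)).
by apply: contraNeq Wn1 => c0; rewrite -[W](scalerK c0) memvZ// -ZUc.
Qed.

(** In a nilpotent algebra every ad Z is nilpotent, so 0 is its only eigenvalue. *)
Lemma lie_eigen Z W c : W != 0 -> lie Z W = c *: W -> c = 0.
Proof. by move=> /nilpotent_depth[I WI H]; apply: (H Z W WI).2. Qed.

(** If [W = a *: X + b *: Y], then bracketing with [X] and with [Y] gives [b *: W] and [- a *: W],
    so [a] and [b] vanish by [lie_eigen]. *)
Lemma lie_free X Y : lie X Y != 0 -> free [:: lie X Y; X; Y].
Proof.
set W := lie X Y => W0; have YX : lie Y X = - W by rewrite lieC.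
have Y0 : Y != 0 by apply: contraNneq W0 => Y0; rewrite /W Y0 lie0r.
rewrite !free_cons nil_free span_nil memv0 Y0 span_seq1 !andbT.
apply/andP; split; last first.
  by apply: contraNN W0 => /vlineP[k Xk]; rewrite /W Xk lieZl liexx scaler0.
apply/negP => /span2P[a [b Wab]].
have b0 : b = 0.
  apply: (lie_eigen X W) => //.
  by rewrite {1}Wab lieDr !lieZr liexx scaler0 add0r.
have a0 : - a = 0.
  apply: (lie_eigen Y W) => //.
  by rewrite {1}Wab lieDr !lieZr liexx YX scaler0 addr0 scalerN scaleNr.
by move: W0; rewrite Wab b0 -[a]opprK a0 oppr0 !scale0r addr0 eqxx.
Qed.

(** Otherwise [W] would be an eigenvector of ad Y with eigenvalue 1. The shift serves to move [X]
    off a given plane or line without losing a nonzero bracket. *)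
Lemma lie_shift_neq0 X Y : lie X Y != 0 -> lie (X + lie X Y) Y != 0.
Proof.
set W := lie X Y => W0; rewrite lieDl -/W addrC; apply/negP => /eqP WY.
have := lie_eigen Y W 1 W0; rewrite scale1r (lieC Y) => /(_ (addr0_eq WY)).
by move/eqP; rewrite oner_eq0.
Qed.

(** For central [X] any noncommuting pair works: a central combination of [U] and [V] is zero, as
    bracketing with [U] and [V] shows. For noncentral [X] the pair is [X + lie X Y], [Y]. *)
Lemma lie_pair_ex X : X != 0 -> ~ lie_abelian g ->
  exists U V, free [:: X; U; V] /\ lie U V != 0.
Proof.
move=> X0 nab; have [Xz|/existsNP[Y /eqP W0]] := pselect (lie_center g X).
  have [U [V UV]] : exists U V, lie U V != 0.
    by apply: contra_notP nab => H U V; apply: contra_notP H => /eqP; exists U, V.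
  exists U, V; split=> //; have := lie_free _ _ UV.
  rewrite !free_cons => /andP[_ ->]; rewrite andbT.
  apply: contraNN X0 => /span2P[a [b Xab]].
  have := Xz V; have := Xz U.
  rewrite Xab !lieDl !lieZl !liexx !scaler0 add0r addr0 (lieC V) scalerN.
  move=> /eqP; rewrite oppr_eq0 !scaler_eq0 (negPf UV) orbF => /eqP b0 /eqP.
  by rewrite scaler_eq0 (negPf UV) orbF b0 => /eqP ->; rewrite !scale0r addr0.
set W := lie X Y in W0; exists (X + W), Y; split; last first.
  exact: lie_shift_neq0.
have /free3P WXY := lie_free _ _ W0; apply/free3P => a b c.
rewrite scalerDr addrA -scalerDl [_ + b *: W]addrC => H.
have [b0 ab0 c0] := WXY b (a + b) c H.
by split=> //; rewrite -[a](addrK b) ab0 b0 subr0.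
Qed.

End Nilpotent.

(** * Metrics giving the sectional curvature of a plane a strict sign *)

Section SectionalSigns.
Context {R : realType} {g : lieAlgType R} (nilp : lie_nilpotent g).
Implicit Types (b : {dot g for idfun}) (u v X Y Z U W : g) (s : {vspace g}).

(** Reduces the choice of a metric to that of two functionals: they become the pairings with [X] and
    [Y], [Z] becomes a unit vector orthogonal to both, and the inequality is positivity of [curvU]
    at [Z]. *)
Lemma curvK_pos_functionals X Y Z (fx fy : g -> R) :
    scalar fx -> scalar fy -> Z != 0 ->
    map fx [:: X; Y; Z] = [:: 1; 0; 0] -> map fy [:: X; Y; Z] = [:: 0; 1; 0] ->
    fx (lie Z X) * fy (lie Z Y) < (2^-1 * (fx (lie Z Y) + fy (lie Z X))) ^+ 2 ->
  exists b : {dot g for idfun}, 0 < curvK b X Y.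
Proof.
move=> fxl fyl Z0 fxE fyE D.
have [b [bX bY bZ]] := dot_set2 _ _ _ _ _ fxl fyl Z0 fxE fyE.
move: fxE fyE => [_ _ xZ] [_ _ yZ].
apply: (curvK_pos_ex b _ _ Z); rewrite ?bX ?bY//.
by rewrite /curvU !bX !bY subr_gt0.
Qed.

Lemma curvK_neg_functionals X Y Z (fx fy : g -> R) :
    scalar fx -> scalar fy -> Z != 0 -> lie X Y = 0 ->
    map fx [:: X; Y; Z] = [:: 1; 0; 0] -> map fy [:: X; Y; Z] = [:: 0; 1; 0] ->
    (2^-1 * (fx (lie Z Y) + fy (lie Z X))) ^+ 2 < fx (lie Z X) * fy (lie Z Y) ->
  exists b : {dot g for idfun}, curvK b X Y < 0.
Proof.
move=> fxl fyl Z0 XY fxE fyE D.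
have [b [bX bY bZ]] := dot_set2 _ _ _ _ _ fxl fyl Z0 fxE fyE.
move: fxE fyE => [_ _ xZ] [_ _ yZ].
apply: (curvK_neg_ex b _ _ Z); rewrite ?bX ?bY//.
by rewrite /curvU !bX !bY subr_lt0.
Qed.

(** If [Z] lies in [s], then [Z] and [X] span [s], which [lie Z X] avoids by [lie_free]; adding this
    bracket to [Z] leaves the plane. *)
Lemma transversal_ex s X Z : \dim s = 2%N -> X \in s -> lie Z X != 0 ->
  exists2 Z', Z' \notin s & lie Z' X != 0.
Proof.
move=> ds Xs ZX; have [Zs|Zs] := boolP (Z \in s); last by exists Z.
exists (Z + lie Z X); last exact: lie_shift_neq0.
have := lie_free nilp _ _ ZX; rewrite free_cons => /andP[WZX ZXf].
rewrite rpredDl//; apply: contraNN WZX.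
by rewrite (span_basis (plane_basis _ _ _ ds Zs Xs ZXf)).
Qed.

(** The functionals are chosen with [fx (lie Z X) = 0] and [fx (lie Z Y) + fy (lie Z X) = 1], so
    that the inequality required becomes 0 < 1/4. *)
Lemma plane_curvK_pos s X Z : \dim s = 2%N -> X \in s -> lie Z X != 0 ->
  exists X' Y b, basis_of s [:: X'; Y] /\ 0 < curvK b X' Y.
Proof.
move=> ds Xs /(transversal_ex _ _ _ ds Xs)[{}Z Zs]; set W := lie Z X => W0.
have Z0 : Z != 0 by apply: contraNneq Zs => ->; rewrite mem0v.
have X0 : X != 0 by apply: contraNneq W0 => X0; rewrite /W X0 lie0r.
have WZX : free [:: W; Z; X] := lie_free nilp _ _ W0.
suff [Y [fx [fy [sb [fxl fyl] fxE fyE D]]]] : exists Y fx fy,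
    [/\ basis_of s [:: X; Y], scalar fx /\ scalar fy,
      map fx [:: X; Y; Z] = [:: 1; 0; 0], map fy [:: X; Y; Z] = [:: 0; 1; 0] &
      fx (lie Z X) * fy (lie Z Y)
        < (2^-1 * (fx (lie Z Y) + fy (lie Z X))) ^+ 2].
  have [b b0] := curvK_pos_functionals _ _ _ _ _ fxl fyl Z0 fxE fyE D.
  by exists X, Y, b.
have quarter : 0 < (2^-1 * 1) ^+ 2 :> R by rewrite exprn_gt0// mulr1 invr_gt0.
have [/memv_addP[Y Ys [_ /vlineP[d ->] WE]]|WsZ] := boolP (W \in s + <[Z]>)%VS.
  (* The component of [W] in [s] serves as the second basis vector, so [lie Z Y = lie Z W], and
     [fy W = 1] for [fy] dual to [Y]. *)
  have YE : Y = W - d *: Z by rewrite WE addrK.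
  have XYZ : free [:: X; Y; Z].
    apply/free3P => a b c; rewrite YE scalerBr scalerA => H.
    have [|b0] := (free3P _ _ _).2 WZX b (c - b * d) a; last first.
      by rewrite b0 mul0r subr0.
    by rewrite -H scalerBl !addrA (ACl (4 * 1 * 3 * 2)).
  have sb : basis_of s [:: X; Y].
    apply: plane_basis => //; move: XYZ.
    by rewrite -[_ :: _]/([:: X; Y] ++ [:: Z]) => /catl_free.
  (* Applying ad Z to an expression of [X] in these three vectors would write [W] as the bracket of
     [Z] with a vector at least as deep as [W] in the lower central series. *)
  have [fx fxl [xX fxV]] : exists2 fx, scalar fx &
      fx X = 1 /\ {in <<[:: W; Z; lie Z W]>>%VS, forall v, fx v = 0}.
    apply: separating_functional; apply/negP => /span3P[a [b [c XE]]].
    have [I WI HI] := nilpotent_depth nilp W W0.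
    have [ZWI _] := HI Z W WI.
    have [|_ /(_ 1)] := HI Z (a *: W + c *: lie Z W).
      by rewrite memvD ?memvZ.
    rewrite scale1r => H; suff /eqP : 1 = 0 :> R by rewrite oner_eq0.
    apply: H.
    by rewrite /W {3}XE !lieDr !lieZr liexx scaler0 addr0.
  have [fy fyl [yX yY yZ]] := free_functional _ [:: 0; 1; 0] XYZ erefl.
  have [_ xD xN xZ] := scalar_morph fx fxl; have [_ yD yN yZ'] := scalar_morph fy fyl.
  have xW : fx W = 0 by rewrite fxV// memv_span// mem_head.
  have xZ0 : fx Z = 0 by rewrite fxV// memv_span// !inE eqxx orbT.
  exists Y, fx, fy; split=> //=.
  - by rewrite xX xZ0 YE xD xN xW xZ xZ0 mulr0 subr0.
  - by rewrite yX yY yZ.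
  rewrite -/W xW mul0r [fx (lie Z Y)](_ : _ = 0) ?add0r; last first.
    rewrite YE lieDr lieNr lieZr liexx scaler0 subr0 fxV// memv_span// !inE.
    by rewrite eqxx !orbT.
  by rewrite WE yD yY yZ' yZ mulr0 addr0.
(* Now [W] is independent of [Z] and [s], so the values of both functionals at [W] are free. *)
have [Y sb] := plane_completion _ _ ds Xs X0.
have sE := span_basis sb.
have XYf := basis_free sb.
have ZXY : free [:: Z; X; Y] by rewrite free_cons sE Zs.
have WZXY : free [:: W; Z; X; Y].
  rewrite free_cons ZXY andbT; apply: contraNN WsZ.
  by rewrite span_cons sE addvC.
have XYZW : free [:: X; Y; Z; W].
  by rewrite -(perm_free (X := [:: W; Z; X; Y]))//; apply/permP => p /=; ring.
have [fx fxl [xX xY xZ xW]] := free_functional _ [:: 1; 0; 0; 0] XYZW erefl.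
have [fy fyl [yX yY yZ yW]] :=
  free_functional _ [:: 0; 1; 0; 1 - fx (lie Z Y)] XYZW erefl.
exists Y, fx, fy; split=> //=; rewrite ?xX ?xY ?xZ ?yX ?yY ?yZ//.
by rewrite -/W xW yW mul0r addrC subrK.
Qed.

(** By [lie_free] the bracket can be made a unit vector orthogonal to [X] and [Y], and is then
    lengthened. *)
Lemma plane_curvK_neg_lie X Y : lie X Y != 0 ->
  exists b : {dot g for idfun}, curvK b X Y < 0.
Proof.
move=> W0; have WXY := lie_free nilp _ _ W0.
have [fx fxl [xW xX xY]] := free_functional _ [:: 0; 1; 0] WXY erefl.
have [fy fyl [yW yX yY]] := free_functional _ [:: 0; 0; 1] WXY erefl.
have [||b [bX bY bW]] := dot_set2 X Y _ _ _ fxl fyl W0.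
- by rewrite /= xX xY xW.
- by rewrite /= yX yY yW.
by apply: (curvK_neg_lie_ex b _ _ (lie X Y)); rewrite ?bX ?bY ?bW ?oner_eq0.
Qed.

(** The functionals are chosen so that their matrix on [lie Z X'], [lie Z Y'] has diagonal entries 1
    and off-diagonal entries of sum 0. *)
Lemma plane_curvK_neg s X Y Z : basis_of s [:: X; Y] -> lie X Y = 0 ->
    free [:: lie Z X; lie Z Y] ->
  exists X' Y' b, basis_of s [:: X'; Y'] /\ curvK b X' Y' < 0.
Proof.
move=> sb XY NXY; have sE := span_basis sb; have XYf := basis_free sb.
have ds : \dim s = 2%N by rewrite (size_basis (X := [tuple X; Y])).
have Xs : X \in s by rewrite (basis_mem sb)// mem_head.
have Ys : Y \in s by rewrite (basis_mem sb)// !inE eqxx orbT.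
have sab v : v \in s -> lie Z v = 0 -> v = 0.
  move=> /(basis2P _ _ _ _ sb)[a [b ->]]; rewrite lieDr !lieZr => ab0.
  by have [-> ->] := (free2P _ _).2 NXY a b ab0; rewrite !scale0r addr0.
have Zs : Z \notin s.
  apply/negP => /(basis2P _ _ _ _ sb)[a [b ZE]].
  have YZ : lie Z Y = a *: lie X Y by rewrite ZE lieDl !lieZl liexx scaler0 addr0.
  have := NXY; rewrite free_cons free_cons span_seq1.
  by rewrite YZ XY scaler0 nil_free span_nil mem0v andbF.
have Z0 : Z != 0 by apply: contraNneq Zs => ->; rewrite mem0v.
suff [X' [Y' [fx [fy [sb' [fxl fyl] fxE fyE D]]]]] : exists X' Y' fx fy,
    [/\ basis_of s [:: X'; Y'], scalar fx /\ scalar fy,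
      map fx [:: X'; Y'; Z] = [:: 1; 0; 0],
      map fy [:: X'; Y'; Z] = [:: 0; 1; 0] &
      (2^-1 * (fx (lie Z Y') + fy (lie Z X'))) ^+ 2
        < fx (lie Z X') * fy (lie Z Y')].
  have XY' : lie X' Y' = 0.
    have : X' \in s by rewrite (basis_mem sb')// mem_head.
    have : Y' \in s by rewrite (basis_mem sb')// !inE eqxx orbT.
    move=> /(basis2P _ _ _ _ sb)[a [b ->]] /(basis2P _ _ _ _ sb)[c [d ->]].
    rewrite !(lieDl, lieDr, lieZl, lieZr) !liexx (lieC Y) XY oppr0 !scaler0.
    by rewrite !addr0.
  have [b b0] := curvK_neg_functionals _ _ _ _ _ fxl fyl Z0 XY' fxE fyE D.
  by exists X', Y', b.
(* With all five vectors independent, the matrix can be the identity. *)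
have [F|nF] := boolP (free [:: lie Z X; lie Z Y; Z; X; Y]).
  have [fx fxl [xNX xNY xZ xX xY]] := free_functional _ [:: 1; 0; 0; 1; 0] F erefl.
  have [fy fyl [yNX yNY yZ yX yY]] := free_functional _ [:: 0; 1; 0; 0; 1] F erefl.
  exists X, Y, fx, fy; split=> //=; rewrite ?xX ?xY ?xZ ?yX ?yY ?yZ//.
  by rewrite xNX xNY yNX yNY addr0 mulr0 expr0n mulr1 ltr01.
(* A dependence puts [lie Z Y], or some [lie Z X - a *: lie Z Y], in the span of [Z] and [s]; its
   coefficients give [X']. *)
have [X' [X's X'0 NX']] : exists X', [/\ X' \in s, X' != 0 &
    lie Z X' \in (s + <[Z]>)%VS].
  have ZXYE : <<[:: Z; X; Y]>>%VS = (s + <[Z]>)%VS by rewrite span_cons sE addvC.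
  move: nF; rewrite free_cons negb_and negbK free_cons negb_and negbK.
  rewrite [free [:: Z; X; Y]]free_cons XYf sE Zs orbF.
  case/orP; last first.
    rewrite ZXYE => NYs; exists Y; split=> //.
    by apply: contraTneq XYf => ->; rewrite free_cons seq1_free eqxx andbF.
  rewrite span_cons ZXYE => /memv_addP[_ /vlineP[a ->] [w ws NXE]].
  exists (X - a *: Y); split; first by rewrite rpredB ?memvZ.
    apply: contraTneq XYf => /subr0_eq ->.
    by rewrite free_cons span_seq1 memvZ ?memv_line.
  by rewrite lieDr lieNr lieZr NXE addrC addKr.
have W0 : lie Z X' != 0 by apply: contra_neq X'0 => /sab ->.
set W := lie Z X' in NX' W0; have WZX := lie_free nilp _ _ W0.
rewrite -/W in WZX.
have [u us [_ /vlineP[d ->] WE]] := memv_addP NX'.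
(* With this choice [W = X' + Y' + d *: Z], so functionals dual to [X'] and [Y'] and zero at [Z]
   both take the value 1 at [W]. *)
pose Y' := u - X'; have Y's : Y' \in s by rewrite rpredB.
have Y'E : Y' = W - d *: Z - X' by rewrite WE addrK.
have XY'f : free [:: X'; Y'].
  apply/free2P => a b; rewrite Y'E => H.
  have [|b0 _] := (free3P _ _ _).2 WZX b (- (b * d)) (a - b).
    rewrite -H !scalerBr scalerBl scaleNr scalerA !addrA.
    by rewrite [RHS](ACl (2 * 3 * 1 * 4)).
  by rewrite b0 subr0.
have sb' := plane_basis _ _ _ ds X's Y's XY'f.
(* Otherwise [lie Z W] is a combination of [X'], [W] and [Z]. The depth of [W] excludes [X'], and
   [lie_eigen] excludes the other two. But [lie Z W] is nonzero, since ad Z is injective on [s] and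
   [X' + Y'] is nonzero. *)
have NY'f : lie Z Y' \notin <<[:: Z; X'; Y']>>%VS.
  apply/negP => /span3P[p [q [r NYE]]].
  have [a [m [c NWE]]] : exists a m c, lie Z W = a *: X' + m *: W + c *: Z.
    exists (q - r), (1 + r), (p - r * d).
    have -> : lie Z W = W + lie Z Y'.
      by rewrite Y'E !(lieDr, lieNr) lieZr liexx scaler0 oppr0 addr0 -/W addrC subrK.
    rewrite NYE Y'E !scalerBr !scalerBl scalerDl scale1r scalerA.
    by rewrite !addrA [RHS](ACl (3 * 5 * 1 * 4 * 6 * 2)).
  have [I WI HI] := nilpotent_depth nilp W W0.
  have [NWI _] := HI Z W WI.
  have a0 : a = 0.
    have [|_ /(_ a)->//] := HI Z (lie Z W - m *: W); first by rewrite rpredB ?memvZ.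
    by rewrite lieDr lieNr lieZr {1}NWE !lieDr !lieZr liexx scaler0 addr0 addrK.
  rewrite a0 scale0r add0r in NWE.
  have NW0 : lie Z W != 0.
    apply: contraTneq XY'f => NW0; have XY'0 : X' + Y' = 0.
      apply: sab; first by rewrite rpredD.
      by rewrite Y'E addrC subrK lieDr lieNr lieZr liexx scaler0 subr0.
    by rewrite free_cons span_seq1 -(addr0_eq XY'0) -memvN memv_line.
  have m0 : m = 0.
    apply: (lie_eigen nilp Z (lie Z W)) => //.
    by rewrite {1}NWE lieDr !lieZr liexx scaler0 addr0.
  have c0 : - c = 0.
    apply: (lie_eigen nilp W Z) => //.
    by rewrite lieC NWE m0 scale0r add0r scaleNr.
  move: NW0; rewrite NWE m0 scale0r add0r.
  by rewrite -[c]opprK c0 oppr0 scale0r eqxx.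
have F : free [:: lie Z Y'; Z; X'; Y'].
  by rewrite free_cons NY'f free_cons (span_basis sb') Zs.
(* The value -1 at [lie Z Y'] cancels [fy W = 1] off the diagonal. *)
have [fx fxl [xN xZ xX xY]] := free_functional _ [:: -1; 0; 1; 0] F erefl.
have [fy fyl [yN yZ yX yY]] := free_functional _ [:: 1; 0; 0; 1] F erefl.
have [_ xD _ xM] := scalar_morph fx fxl; have [_ yD _ yM] := scalar_morph fy fyl.
have WE' : W = X' + Y' + d *: Z by rewrite WE -[X' + _]addrC subrK.
clearbody Y'; exists X', Y', fx, fy; split=> //=; rewrite ?xX ?xY ?xZ ?yX ?yY ?yZ//.
rewrite -/W xN yN WE' !xD !yD xM yM xX xY xZ yX yY yZ.
by rewrite mulr0 !addr0 add0r addNr mulr0 expr0n mulr1 ltr01.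
Qed.

End SectionalSigns.

(** * Signs of the Ricci curvature *)

Section RicciSigns.
Context {R : realType} {g : lieAlgType R}.
Implicit Types (b : {dot g for idfun}) (u v X Y Z U W : g) (s : {vspace g}).

Lemma ricci_center b e X : orthonormal_basis b e -> lie_center g X ->
  ricci b X = 1 / 4 * \sum_(u <- e) \sum_(v <- e) b X (lie u v) ^+ 2.
Proof.
move=> eb Xz; rewrite (ricciE _ eb) /ricci_onb [X in _ - _ * X]big1 => [|u _].
  by rewrite mulr0 subr0.
by rewrite Xz dot0l.
Qed.

Lemma ricci_center_ge0 b X : lie_center g X -> 0 <= ricci b X.
Proof.
move=> Xz; have [e eb] := orthonormal_basis_ex b; rewrite (ricci_center _ _ _ eb)//.
rewrite mulr_ge0 ?divr_ge0//; apply: sumr_ge0 => u _; apply: sumr_ge0 => v _.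
exact: sqr_ge0.
Qed.

(** Zero curvature would make [X] orthogonal to all brackets of basis vectors, hence to the derived
    algebra, which contains [X]. *)
Lemma ricci_center_gt0 b X : lie_center g X -> X \in lie_derived g -> X != 0 ->
  0 < ricci b X.
Proof.
move=> Xz Xg' X0; rewrite lt_def ricci_center_ge0// andbT.
have [e eb] := orthonormal_basis_ex b; rewrite (ricci_center _ _ _ eb)//.
have q0 : 1 / 4 != 0 :> R by rewrite lt0r_neq0 ?divr_gt0.
apply: contraNneq X0 => /eqP; rewrite mulf_eq0 (negPf q0) /= psumr_eq0; last first.
  by move=> u _; apply: sumr_ge0 => v _; exact: sqr_ge0.
move=> /allP Xe; rewrite -(dot_eq0 b).
suff /subvP/(_ _ Xg') : (lie_derived g <= orthov b <[X]>)%VS by rewrite mem_orthov1.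
apply: lieprod_sub => u v _ _; rewrite mem_orthov1; apply/eqP; rewrite [LHS](dotC b).
rewrite (orthonormal_sum u eb) (orthonormal_sum v eb).
rewrite linear_sumlz linear_sumr big_seq big1// => p pe.
rewrite /= lieZl dotZr linear_sumr linear_sumr /= big_seq big1 ?mulr0// => q qe.
have := Xe p pe; rewrite psumr_eq0 => [/allP/(_ q qe)|? _]; last exact: sqr_ge0.
by rewrite /= sqrf_eq0 lieZr dotZr => /eqP ->; rewrite mulr0.
Qed.

(** The metric makes [X] orthogonal to the derived algebra. *)
Lemma ricci_center_eq0 X : lie_center g X -> X \notin lie_derived g ->
  exists b : {dot g for idfun}, ricci b X = 0.
Proof.
move=> Xz /separating_functional[f fl [fX fg']]; have [b0 _] := @dot_nonempty R g.
have [b [bX _]] := dot_set b0 X f fl fX; exists b.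
have [e eb] := orthonormal_basis_ex b; rewrite (ricci_center _ _ _ eb)//.
rewrite big1 ?mulr0// => u _; rewrite big1// => v _.
by rewrite bX fg' ?expr0n// memv_lieprod ?memvf.
Qed.

Lemma ricci0 b : ricci b 0 = 0.
Proof.
have [e eb] := orthonormal_basis_ex b; rewrite (ricci_center _ _ _ eb).
  by rewrite big1 ?mulr0// => u _; rewrite big1// => v _; rewrite dot0l expr0n.
by move=> v; rewrite lieC lie0r oppr0.
Qed.

Hypothesis nilp : lie_nilpotent g.

Lemma ricci_noncenter_lt0 X : ~ lie_center g X ->
  exists b : {dot g for idfun}, ricci b X < 0.
Proof.
move=> /existsNP[Y /eqP W0]; have F := lie_free nilp _ _ W0.
have [fx fxl [xW xX xY]] := free_functional _ [:: 0; 1; 0] F erefl.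
have [fy fyl [yW yX yY]] := free_functional _ [:: 0; 0; 1] F erefl.
have [||b [bX bY bW]] := dot_set2 X Y _ _ _ fxl fyl W0.
- by rewrite /= xX xY xW.
- by rewrite /= yX yY yW.
by apply: (ricci_neg_ex b X Y); rewrite ?bX ?bY.
Qed.

Lemma ricci_nonzero_gt0 X : ~ lie_abelian g -> X != 0 ->
  exists b : {dot g for idfun}, 0 < ricci b X.
Proof.
move=> nonab X0; have [U [V [F UV]]] := lie_pair_ex nilp _ X0 nonab.
have V0 : V != 0 by apply: (free_not0 F); rewrite !inE eqxx !orbT.
have [fx fxl [[xX xU xV] xW]] : exists2 fx, scalar fx &
    map fx [:: X; U; V] = [:: 1; 0; 0] /\ fx (lie U V) != 0.
  (* If [lie U V] lies in the span, its [X]-coordinate is nonzero, because [lie U V] is independent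
     of [U] and [V]; otherwise its value under [fx] can be prescribed. *)
  have [/span3P[a [k [c UVE]]]|UVf] := boolP (lie U V \in <<[:: X; U; V]>>%VS).
    have [fx fxl fxE] := free_functional _ [:: 1; 0; 0] F erefl.
    exists fx => //; split=> //; move: fxE => [xX xU xV].
    have [_ xD _ xM] := scalar_morph fx fxl.
    rewrite UVE !xD !xM xX xU xV mulr1 !mulr0 !addr0.
    have := lie_free nilp _ _ UV; rewrite free_cons => /andP[+ _].
    apply: contraNneq => a0; apply/span2P; exists k, c.
    by rewrite UVE a0 scale0r add0r.
  have F4 : free [:: lie U V; X; U; V] by rewrite free_cons UVf.
  have [fx fxl [xW xX xU xV]] := free_functional _ [:: 1; 1; 0; 0] F4 erefl.
  by exists fx => //; rewrite /= xX xU xV xW oner_eq0.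
have [fu ful fuE] := free_functional _ [:: 0; 1; 0] F erefl.
have [|b [bX bU bV]] := dot_set2 X U _ _ _ fxl ful V0 _ fuE.
  by rewrite /= xX xU xV.
move: fuE => [uX uU uV].
by apply: (ricci_pos_ex b X U V); rewrite ?bX ?bU.
Qed.

End RicciSigns.

(** * Planes of nonnegative and of nonpositive curvature *)

Section SectionalSets.
Context {R : realType} {g : lieAlgType R}.
Implicit Types (b : {dot g for idfun}) (u v X Y Z U W : g) (s : {vspace g}).

(** The normalising factor is positive, so the sign can be tested on any basis of the plane. *)
Lemma sectional_sg b s X Y : basis_of s [:: X; Y] ->
  Num.sg (sectional b s) = Num.sg (curvK b X Y).
Proof.
move=> sb; rewrite (sectionalE b sb) sgrM sgrV.
suff w0 : 0 < sqnorm_wedge b X Y by rewrite (gtr0_sg w0) mulr1.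
rewrite /sqnorm_wedge; have XYf := basis_free sb.
have X0 : X != 0 by apply: (free_not0 XYf); rewrite mem_head.
(* The square length of this vector is [b X X * sqnorm_wedge b X Y]. *)
have v0 : b X X *: Y - b X Y *: X != 0.
  apply: contraNneq (lt0r_neq0 (dot_gt0 b X X0)) => v0.
  rewrite addrC -scaleNr in v0.
  by have [_ ->] := (free2P _ _).2 XYf _ _ v0.
have := dot_gt0 b _ v0.
rewrite dotDl dotNl !(dotDr, dotNr, dotZl, dotZr) (dotC b Y X) => H.
by rewrite -(pmulr_rgt0 _ (dot_gt0 b X X0)); move: H; congr (0 < _); ring.
Qed.

Lemma curvK_comm b e X Y : orthonormal_basis b e -> lie X Y = 0 ->
  curvK b X Y = \sum_(z <- e) curvU b X Y z.
Proof.
move=> eb XY; have YX : lie Y X = 0 by rewrite lieC XY oppr0.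
by rewrite (curvKE _ _ _ _ eb) XY YX !lie0r !dot0l; ring.
Qed.

Lemma curvK_comm_eq0 b X Y : lie X Y = 0 -> (forall z, curvU b X Y z = 0) ->
  curvK b X Y = 0.
Proof.
have [e eb] := orthonormal_basis_ex b.
by move=> XY U0; rewrite (curvK_comm _ _ _ _ eb XY) big1.
Qed.

Lemma parallelP u v :
  reflect (exists p q, (p != 0) || (q != 0) /\ p *: u + q *: v = 0)
    (parallel u v).
Proof.
apply: (iffP idP) => [|[p [q [pq pquv]]]]; last first.
  apply: contraTN pq => /free2P/(_ _ _ pquv)[-> ->].
  by rewrite eqxx.
rewrite /parallel free_cons seq1_free span_seq1 negb_and !negbK.
case/orP => [/vlineP[k ->]|/eqP ->]; last first.
  by exists 0, 1; rewrite oner_eq0 orbT scale0r scaler0 addr0.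
by exists 1, (- k); rewrite oner_eq0 scale1r scaleNr subrr.
Qed.

(** Every [curvU] term is a square: for [lie X z = k *: lie Y z] the mean of the mixed pairings and
    the product of the diagonal ones combine into the square of half a difference. *)
Lemma curvK_parallel_ge0 b X Y : lie X Y = 0 ->
  (forall Z, parallel (lie X Z) (lie Y Z)) -> 0 <= curvK b X Y.
Proof.
have [e eb] := orthonormal_basis_ex b => XY par.
rewrite (curvK_comm _ _ _ _ eb XY) sumr_ge0// => z _; rewrite /curvU.
have := par z; rewrite /parallel free_cons seq1_free span_seq1 negb_and !negbK.
rewrite !(lieC z).
case/orP => [/vlineP[k ->]|/eqP ->]; rewrite !dotNr ?dotZr.
  rewrite (_ : _ - _ = (2^-1 * (b X (lie Y z) - k * b Y (lie Y z))) ^+ 2).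
    exact: sqr_ge0.
  by field.
by rewrite (dotC b _ 0) (dotC b Y 0) !dot0l oppr0 mulr0 subr0 sqr_ge0.
Qed.

(** The last condition says that every ad Z restricted to [s] has rank at most one. *)
Definition flat_pencil s := [/\ grassmannian2 setT s, lieprod s s = 0%VS
  & forall Z, exists X, [/\ X \in s, X != 0 & lie X Z = 0]].

Lemma flat_pencil_parallel s X Y : flat_pencil s -> basis_of s [:: X; Y] ->
  lie X Y = 0 /\ forall Z, parallel (lie X Z) (lie Y Z).
Proof.
move=> [_ ss0 sZ] sb; split=> [|Z].
  apply/eqP; rewrite -memv0 -ss0 memv_lieprod// (basis_mem sb)// !inE eqxx//.
  by rewrite orbT.
have [v [vs v0 vZ]] := sZ Z; have [p [q [vE pq]]] := basis2_neq0 _ _ _ _ sb vs v0.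
by apply/parallelP; exists p, q; rewrite -!lieZl -lieDl -vE.
Qed.

Lemma plane_basis_ex s : \dim s = 2%N -> exists X Y, basis_of s [:: X; Y].
Proof.
move=> ds; have s0 : s != 0%VS by rewrite -dimv_eq0 ds.
have [|Y sb] := plane_completion _ _ ds (memv_pick s); first by rewrite vpick0.
by exists (vpick s), Y.
Qed.

(** A relation [p *: lie X Z + q *: lie Y Z = 0] says that [p *: X + q *: Y] commutes with [Z]. *)
Lemma span_planes_flat_pencil :
  span_planes (fun X Y : g =>
    lie X Y = 0 /\ forall Z, parallel (lie X Z) (lie Y Z)) = flat_pencil.
Proof.
apply/seteqP; split=> [s [X [Y [sb [XY par]]]]|s ss]; last first.
  have [[ds _] _ _] := ss; have [X [Y sb]] := plane_basis_ex _ ds.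
  by exists X, Y; split=> //; exact: flat_pencil_parallel sb.
split.
- by split=> //; rewrite (size_basis (X := [tuple X; Y])).
- apply/eqP; rewrite -subv0; apply: lieprod_sub => u v.
  move=> /(basis2P _ _ _ _ sb)[p [q ->]] /(basis2P _ _ _ _ sb)[r [t ->]].
  rewrite !(lieDl, lieDr, lieZl, lieZr) !liexx (lieC Y) XY oppr0 !scaler0.
  by rewrite !addr0 mem0v.
move=> Z; have /parallelP[p [q [pq pqZ]]] := par Z.
exists (p *: X + q *: Y); split.
- by apply/(basis2P _ _ _ _ sb); exists p, q.
- apply: contraTneq pq => /((free2P _ _).2 (basis_free sb))[-> ->].
  by rewrite eqxx.
by rewrite lieDl !lieZl.
Qed.

Hypothesis nilp : lie_nilpotent g.

Lemma sectional_ge0 : sectional_always g [set r | 0 <= r] = flat_pencil.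
Proof.
apply/seteqP; split=> s; last first.
  move=> ss; split; first by have [] := ss.
  move=> b; have [[ds _] _ _] := ss; have [X [Y sb]] := plane_basis_ex _ ds.
  have [XY par] := flat_pencil_parallel _ _ _ ss sb.
  by rewrite /= -sgr_ge0 (sectional_sg _ _ _ _ sb) sgr_ge0 curvK_parallel_ge0.
move=> [[ds _] sge]; have [X [Y sb]] := plane_basis_ex _ ds.
rewrite -span_planes_flat_pencil; exists X, Y; split=> //.
have XY : lie X Y = 0.
  apply: contrapT => /eqP /(plane_curvK_neg_lie nilp)[b].
  by rewrite -sgr_lt0 -(sectional_sg _ _ _ _ sb) sgr_lt0 ltNge (sge b).
split=> // Z; apply/negP => F; have [] := plane_curvK_neg nilp s X Y Z sb XY.
  have := F; rewrite (lieC X) (lieC Y) => /free2P F'; apply/free2P => p q pq0.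
  by apply: F'; rewrite !scalerN -opprD pq0 oppr0.
move=> X' [Y' [b [sb']]].
by rewrite -sgr_lt0 -(sectional_sg _ _ _ _ sb') sgr_lt0 ltNge (sge b).
Qed.

Lemma center_sectional_eq0 b s : grassmannian2 (lie_center g) s ->
  sectional b s = 0.
Proof.
move=> [ds sz]; have [X [Y sb]] := plane_basis_ex _ ds.
have Xz : lie_center g X by apply: sz; rewrite /= (basis_mem sb)// mem_head.
have Yz : lie_center g Y by apply: sz; rewrite /= (basis_mem sb)// !inE eqxx orbT.
apply/eqP; rewrite -sgr_eq0 (sectional_sg _ _ _ _ sb) sgr_eq0; apply/eqP.
apply: curvK_comm_eq0 => [|z]; first exact: Xz.
by rewrite /curvU !(lieC z) Xz Yz oppr0 !(dotC b _ 0) !dot0l; ring.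
Qed.

Lemma sectional_le0_center s : sectional_always g [set r | r <= 0] s ->
  grassmannian2 (lie_center g) s.
Proof.
move=> [[ds _] sle]; split=> // X /= Xs; apply: contrapT => /existsNP[Z XZ].
have ZX : lie Z X != 0 by rewrite lieC oppr_eq0; apply/eqP.
have [X' [Y [b [sb]]]] := plane_curvK_pos nilp s X Z ds Xs ZX.
by rewrite -sgr_gt0 -(sectional_sg _ _ _ _ sb) sgr_gt0 ltNge (sle b).
Qed.

End SectionalSets.

(** * Planes of positive curvature *)

Section PositivePlanes.
Context {R : realType} {g : lieAlgType R}.
Implicit Types (b : {dot g for idfun}) (u v X Y Z U W T : g) (s : {vspace g}).

(** For central [X] the curvature reduces to the square length of [metricU b X Y], whose pairing
    with [Z] is minus half that of [X] with itself. *)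
Lemma curvK_center_gt0 b X Y Z : lie_center g X -> lie Y Z = X -> X != 0 ->
  0 < curvK b X Y.
Proof.
move=> Xz YZ X0; have YX : lie Y X = 0 by rewrite lieC Xz oppr0.
have UXX : metricU b X X = 0.
  by apply: (dot_inj (b := b)) => v;
    rewrite metricUE lieC Xz oppr0 (dotC b X) !dot0l addr0 mulr0.
rewrite /curvK UXX Xz YX !lie0r !dot0l !mulr0 !subr0 dot_gt0//.
apply: contraNneq (lt0r_neq0 (dot_gt0 b X X0)) => U0.
have := metricUE b X Y Z; rewrite U0 dot0l (lieC Z X) Xz (lieC Z Y) YZ oppr0.
rewrite (dotC b Y) dot0l addr0 dotNr => /esym/eqP.
by rewrite mulf_eq0 oppr_eq0 invr_eq0 pnatr_eq0.
Qed.

(** The metric makes [X] orthogonal to the image of ad Y. *)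
Lemma curvK_center_eq0 X Y : lie_center g X -> ~ range (lie Y) X ->
  exists b : {dot g for idfun}, curvK b X Y = 0.
Proof.
move=> Xz XY.
pose adY : {linear g -> g} := HB.pack_for {linear g -> g} (lie Y)
  (GRing.isLinear.Build R g g *:%R (lie Y) (lie_linearr Y)).
have adYE : linfun adY =1 lie Y := lfunE adY.
have [|f fl [fX fY]] := separating_functional X (limg (linfun adY)).
  by apply/negP => /memv_imgP[v _ Xv]; apply: XY; exists v; rewrite // Xv adYE.
have [b0 _] := @dot_nonempty R g; have [b [bX _]] := dot_set b0 X f fl fX.
exists b; apply: curvK_comm_eq0 => [|z]; first exact: Xz.
have fYz : f (lie Y z) = 0.
  by rewrite fY//; apply/memv_imgP; exists z; [exact: memvf|rewrite adYE].
by rewrite /curvU !(lieC z) Xz oppr0 !(dotC b _ 0) !dot0l dotNr bX fYz; ring.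
Qed.

Hypothesis nilp : lie_nilpotent g.

(* A linear space of maps of rank at most one without a common kernel has a
   common image line; here the maps are the brackets with Z, restricted to s. *)
Lemma flat_pencil_image s : flat_pencil s ->
    (forall X, X \in s -> lie_center g X -> X = 0) ->
  exists X Y T, [/\ basis_of s [:: X; Y], T != 0 &
    forall Z, lie Z X \in <[T]>%VS /\ lie Z Y \in <[T]>%VS].
Proof.
move=> ss sz; have [[ds _] _ sZ] := ss; have [Y [Y' sY]] := plane_basis_ex _ ds.
have Ys : Y \in s by rewrite (basis_mem sY)// mem_head.
have Y0 : Y != 0 by apply: (free_not0 (basis_free sY)); rewrite mem_head.
have noncentral X : X \in s -> X != 0 -> exists Z, lie Z X != 0.
  move=> Xs /eqP X0; have /existsNP[Z XZ] : ~ lie_center g X by move=> /(sz X Xs).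
  by exists Z; rewrite lieC oppr_eq0; apply/eqP.
have [Z0 T0] := noncentral Y Ys Y0; set T := lie Z0 Y in T0.
(* On [s], ad Z0 has rank one: it kills [X] and maps [Y] to [T]. *)
have [X [Xs X0 XZ0]] := sZ Z0.
have Z0X : lie Z0 X = 0 by rewrite lieC XZ0 oppr0.
have sb : basis_of s [:: X; Y].
  apply: plane_basis => //; rewrite (perm_free (Y := [:: Y; X])); last first.
    by rewrite (perm_catC [:: X] [:: Y]).
  rewrite free_cons seq1_free X0 span_seq1 andbT.
  by apply: contraNN T0 => /vlineP[k YE]; rewrite /T YE lieZr Z0X scaler0.
have [_ par] := flat_pencil_parallel _ _ _ ss sb.
have XYline Z : lie Z X != 0 -> lie Z Y \in <[lie Z X]>%VS.
  move=> ZX; have /parallelP[p [q [pq]]] := par Z.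
  rewrite !(lieC _ Z) !scalerN -opprD => /eqP; rewrite oppr_eq0 => /eqP pqZ.
  have q0 : q != 0.
    apply: contraTneq pq => q0; move: pqZ; rewrite q0 scale0r addr0 => /eqP.
    by rewrite scaler_eq0 (negPf ZX) orbF => /eqP ->; rewrite eqxx.
  apply/vlineP; exists (- (q^-1 * p)); rewrite scaleNr -scalerA.
  by rewrite -[LHS](scalerK q0) -(addr0_eq pqZ) scalerN.
have imT Z : lie Z X != 0 -> lie Z X \in <[T]>%VS /\ lie Z Y \in <[T]>%VS.
  (* Adding [Z0] to [Z] keeps the bracket with [X] and adds [T] to that with [Y], so [T] lies on the
     line of [lie Z X]. *)
  move=> ZX; have ZY := XYline Z ZX; have := XYline (Z + Z0).
  rewrite !lieDl Z0X addr0 -/T => /(_ ZX); rewrite rpredDl//.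
  move=> /vlineP[k TE]; have k0 : k != 0.
    by apply: contraNneq T0 => k0; rewrite TE k0 scale0r.
  have ZXT : lie Z X \in <[T]>%VS.
    by apply/vlineP; exists k^-1; rewrite TE scalerK.
  split=> //; move: ZY => /vlineP[l ->]; exact: memvZ.
have [Z1 Z1X] := noncentral X Xs X0.
exists X, Y, T; split=> // Z.
have [ZX|] := eqVneq (lie Z X) 0; last exact: imT.
(* A [Z] that commutes with [X] is replaced by [Z + Z1], which does not. *)
rewrite ZX mem0v; split=> //; have [_ Z1Y] := imT Z1 Z1X.
have [|_] := imT (Z + Z1); first by rewrite lieDl ZX add0r.
by rewrite lieDl rpredDr.
Qed.

Lemma sectional_gt0 : sectional_always g [set r | 0 < r] =
  span_planes (fun X Y : g => (range (lie Y) `&` lie_center g) X).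
Proof.
apply/seteqP; split=> s; last first.
  move=> [X [Y [sb [[Z _ YZ] Xz]]]]; split.
    by split=> //; rewrite (size_basis (X := [tuple X; Y])).
  move=> b; rewrite /= -sgr_gt0 (sectional_sg _ _ _ _ sb) sgr_gt0.
  apply: (curvK_center_gt0 b X Y Z) => //.
  by apply: (free_not0 (basis_free sb)); rewrite mem_head.
move=> [[ds sT] sgt].
have ss : flat_pencil s.
  by rewrite -(sectional_ge0 nilp); split=> // b; exact/ltW/sgt.
have Kgt b X Y : basis_of s [:: X; Y] -> curvK b X Y <> 0.
  move=> sb K0; have := sgt b.
  by rewrite /= -sgr_gt0 (sectional_sg _ _ _ _ sb) K0 sgr0 ltxx.
have [[X [Xs X0 Xz]]|noz] :=
    pselect (exists X, [/\ X \in s, X != 0 & lie_center g X]).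
  have [Y sb] := plane_completion _ _ ds Xs X0; exists X, Y; split=> //; split=> //.
  apply: contrapT => /(curvK_center_eq0 _ _ Xz)[b].
  exact: Kgt.
have sz X : X \in s -> lie_center g X -> X = 0.
  by move=> Xs Xz; apply: contra_notP noz => /eqP X0; exists X.
have [X [Y [T [sb T0 imT]]]] := flat_pencil_image _ ss sz.
(* If [T] were in [s], every ad Z would map it into its own line, hence to 0 by [lie_eigen], and [T]
   would be central. *)
have Ts : T \notin s.
  apply/negP => Ts; have /eqP := T0; apply; apply: sz => // Z.
  rewrite lieC; apply/eqP; rewrite oppr_eq0.
  have [p [q TE]] := basis2P _ _ _ _ sb Ts.
  have : lie Z T \in <[T]>%VS.
    have [ZX ZY] := imT Z.
    by rewrite {1}TE lieDr !lieZr rpredD ?memvZ.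
  by move=> /vlineP[k ZT]; rewrite ZT (lie_eigen nilp Z T k)// scale0r.
have F : free [:: T; X; Y] by rewrite free_cons (span_basis sb) Ts (basis_free sb).
have [fx fxl [xT xX xY]] := free_functional _ [:: 0; 1; 0] F erefl.
have [fy fyl [yT yX yY]] := free_functional _ [:: 0; 0; 1] F erefl.
(* With [T] orthogonal to [X] and [Y], all [curvU] terms vanish. *)
have [||b [bX bY bT]] := dot_set2 X Y _ _ _ fxl fyl T0.
- by rewrite /= xX xY xT.
- by rewrite /= yX yY yT.
case: (Kgt b X Y sb); have [XY _] := flat_pencil_parallel _ _ _ ss sb.
apply: curvK_comm_eq0 => // Z; have [/vlineP[k ZX] /vlineP[l ZY]] := imT Z.
by rewrite /curvU ZX ZY !dotZr !bX !bY xT yT; ring.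
Qed.

End PositivePlanes.

(** * Assembly of the set equalities *)

Theorem theorem1 (R : realType) (g : lieAlgType R)
    (nilp : lie_nilpotent g) (nonab : ~ lie_abelian g) :
  [/\ ricci_always g [set r | r < 0] = set0,
      ricci_always g [set r | r <= 0] = [set 0],
      ricci_always g [set r | r = 0] = [set 0],
      ricci_always g [set r | 0 <= r] = lie_center g
    & ricci_always g [set r | 0 < r] =
      ([set` lie_derived g] `&` lie_center g) `\ 0] /\
  [/\ sectional_always g [set r | r < 0] = set0,
      sectional_always g [set r | r <= 0] = grassmannian2 (lie_center g),
      sectional_always g [set r | r = 0] = grassmannian2 (lie_center g),
      sectional_always g [set r | 0 <= r] =
        span_planes (fun X Y : g =>
          lie X Y = 0 /\ forall Z, parallel (lie X Z) (lie Y Z)) /\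
      sectional_always g [set r | 0 <= r] =
        [set s : {vspace g} | [/\ grassmannian2 setT s, lieprod s s = 0%VS
          & forall Z, exists X, [/\ X \in s, X != 0 & lie X Z = 0]]]
    & sectional_always g [set r | 0 < r] =
        span_planes (fun X Y : g => (range (lie Y) `&` lie_center g) X)].
Proof.
(* A strict inequality for all metrics is refuted by evaluating it at one metric, so some metric
   must exist. *)
have [b0 _] := @dot_nonempty R g.
have ric_le0 X : (forall b : {dot g for idfun}, ricci b X <= 0) -> X = 0.
  move=> Xle; apply: contrapT => /eqP /(ricci_nonzero_gt0 nilp _ nonab)[b].
  by rewrite ltNge Xle.
have ric_ge0 X : (forall b : {dot g for idfun}, 0 <= ricci b X) -> lie_center g X.
  move=> Xge; apply: contrapT => /(ricci_noncenter_lt0 nilp)[b].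
  by rewrite ltNge Xge.
split; split.
- apply/seteqP; split=> // X Xlt.
  have X0 : X = 0 by apply: ric_le0 => b; exact/ltW/Xlt.
  by have := Xlt b0; rewrite X0 /= ricci0 ltxx.
- by apply/seteqP; split=> [X /ric_le0 //|X -> b]; rewrite /= ricci0.
- apply/seteqP; split=> [X X0|X -> b]; last by rewrite /= ricci0.
  by apply: ric_le0 => b; rewrite (X0 b).
- by apply/seteqP; split=> [X /ric_ge0 //|X Xz b]; exact: ricci_center_ge0.
- apply/seteqP; split=> [X Xgt|X [[Xg' Xz] X0] b]; last first.
    by apply: ricci_center_gt0 => //; apply/eqP.
  have Xz : lie_center g X by apply: ric_ge0 => b; exact/ltW/Xgt.
  split; last by move=> X0; have := Xgt b0; rewrite X0 /= ricci0 ltxx.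
  split=> //; apply: contrapT => /negP /(ricci_center_eq0 _ Xz)[b b_X].
  by have := Xgt b; rewrite /= b_X ltxx.
- apply/seteqP; split=> // s [sT slt].
  have /sectional_le0_center : sectional_always g [set r | r <= 0] s.
    by split=> // b; exact/ltW/slt.
  move=> /(_ nilp)/(center_sectional_eq0 b0) s0.
  by have := slt b0; rewrite /= s0 ltxx.
- apply/seteqP; split=> s; first exact: sectional_le0_center.
  by move=> sz; split=> [|b]; [case: sz|rewrite /= (center_sectional_eq0 b _ sz)].
- apply/seteqP; split=> s.
    move=> [sT s0]; apply: sectional_le0_center => //; split=> // b.
    by rewrite /= (s0 b).
  by move=> sz; split=> [|b]; [case: sz|rewrite /= (center_sectional_eq0 b _ sz)].
- by split; rewrite ?span_planes_flat_pencil sectional_ge0.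
- exact: sectional_gt0.
Qed.
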